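(* Let $i,j,k$ be integers with $j>0$ and $0\le k<i$, and suppose the virtual link diagram $(i,j,k)$ has exactly one component, i.e. it is a virtual knot. Then $(i,j,k)$ is virtually null-homotopic and \[ \mathrm{vu}((i,j,k))=\frac{(i-1)(j-1)+k}{2}. \]
   Context: Virtual knots: a virtual knot diagram is a knot diagram some of whose crossings are virtual crossings, drawn with a small circle and carrying no over/under information; the other crossings are classical. Two diagrams represent the same virtual knot iff they are related by planar isotopy and generalized Reidemeister moves: classical R1–R3, virtual VR1–VR3, and the mixed move MR. A crossing change exchanges over- and understrand at a classical crossing. A virtual knot is virtually null-homotopic if generalized Reidemeister moves and crossing changes turn it into the unknot; for such a $K$, $\mathrm{vu}(K)$ (the virtual unknotting number) is the minimal number of crossing changes needed (with any number of generalized Reidemeister moves) to turn $K$ into the unknot. Braid conventions: braids on $i$ strands are drawn horizontally, oriented left to right, with positions $1,\dots,i$ numbered from top to bottom, and words are read left to right. The generator $\sigma_m$ is a classical (positive) crossing at which the strand in position $m$ moves to position $m+1$, passing over the strand moving from position $m+1$ to position $m$. $VB^1_{i,j}$ is the virtual braid obtained from $(\sigma_1\cdots\sigma_{i-1})^j$ by replacing the crossings of the first (left-most) block $\sigma_1\cdots\sigma_{i-1}$ by virtual crossings. In this block, the left-most overstrand passes over all other strands. $B_k=\sigma_k\sigma_{k-1}\cdots\sigma_1$, with $B_0$ the trivial braid. The diagram $(i,j,k)$ is the closure of the product $VB^1_{i,j}B_k$. *)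

(* Defs.v *)
(* Virtual knots are modelled by their signed Gauss codes (Kauffman; Goussarov-Polyak-Viro):
   a virtual knot diagram up to planar isotopy and the virtual moves VR1-VR3, MR is
   exactly its signed Gauss code read cyclically, and the classical Reidemeister moves
   R1-R3 become the moves on Gauss codes defined below. *)
From mathcomp Require Import all_boot.
Set Implicit Arguments. Unset Strict Implicit. Unset Printing Implicit Defensive.

(* A letter of a Gauss code: (crossing label, passing over?, crossing sign positive?) *)
Definition letter := (nat * bool * bool)%type.
Definition word := seq letter.
Definition lab (l : letter) : nat := l.1.1.
Definition labels (w : word) : seq nat := map lab w.

Definition oriented (r : bool) (s : word) : word := if r then rev s else s.

(* Local model of an R3 move: three straight strands s1,s2,s3 drawn left to right,
   at positions 1,2,3 (top to bottom) on the left.  e12 (resp. e13, e23) says that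
   s1 is over s2 (resp. s1 over s3, s2 over s3); r1 r2 r3 say whether the knot
   traverses the strand right-to-left.  The crossing s_p s_q (p<q) has sign
   e_pq xor r_p xor r_q (for left-to-right strands: positive iff the strand moving
   downwards is over, as for sigma_m).  Before the move the crossings occur in the
   order of sigma1 sigma2 sigma1, after it in the order of sigma2 sigma1 sigma2,
   i.e. the order of the two crossings on each strand is reversed.
   [r3arc .. after t] is the piece of Gauss code read along strand s_(t+1). *)
Definition r3arc (e12 e13 e23 r1 r2 r3 : bool) (x y z : nat) (after : bool)
    (t : nat) : word :=
  let sx := addb e12 (addb r1 r2) in
  let sy := addb e13 (addb r1 r3) in
  let sz := addb e23 (addb r2 r3) in
  match t with
  | 0 => oriented (addb r1 after) [:: (x, e12, sx); (y, e13, sy)]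
  | 1 => oriented (addb r2 after) [:: (x, ~~ e12, sx); (z, e23, sz)]
  | _ => oriented (addb r3 after) [:: (y, ~~ e13, sy); (z, ~~ e23, sz)]
  end.

Inductive gstep : word -> word -> Prop :=
| gs_rot a w : gstep (a :: w) (rcons w a)
| gs_R1 u v c b s :
    c \notin labels (u ++ v) ->
    gstep (u ++ v) (u ++ [:: (c, b, s); (c, ~~ b, s)] ++ v)
| gs_R2 u1 u2 u3 a b o s sw :
    a != b -> a \notin labels (u1 ++ u2 ++ u3) -> b \notin labels (u1 ++ u2 ++ u3) ->
    gstep (u1 ++ u2 ++ u3)
          (u1 ++ [:: (a, o, s); (b, o, ~~ s)] ++ u2 ++
           (if sw then [:: (b, ~~ o, ~~ s); (a, ~~ o, s)]
                  else [:: (a, ~~ o, s); (b, ~~ o, ~~ s)]) ++ u3)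
| gs_R3 u0 u1 u2 u3 e12 e13 e23 r1 r2 r3 x y z p0 p1 p2 :
    ~~ [&& e12, ~~ e13 & e23] -> ~~ [&& ~~ e12, e13 & ~~ e23] ->
    uniq [:: x; y; z] ->
    perm_eq [:: p0; p1; p2] [:: 0; 1; 2] ->
    all (fun c => c \notin labels (u0 ++ u1 ++ u2 ++ u3)) [:: x; y; z] ->
    gstep (u0 ++ r3arc e12 e13 e23 r1 r2 r3 x y z false p0 ++ u1
              ++ r3arc e12 e13 e23 r1 r2 r3 x y z false p1 ++ u2
              ++ r3arc e12 e13 e23 r1 r2 r3 x y z false p2 ++ u3)
          (u0 ++ r3arc e12 e13 e23 r1 r2 r3 x y z true p0 ++ u1
              ++ r3arc e12 e13 e23 r1 r2 r3 x y z true p1 ++ u2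
              ++ r3arc e12 e13 e23 r1 r2 r3 x y z true p2 ++ u3).

Inductive vk_eq : word -> word -> Prop :=
| vk_refl w : vk_eq w w
| vk_step w w' : gstep w w' -> vk_eq w w'
| vk_sym w w' : vk_eq w w' -> vk_eq w' w
| vk_trans w1 w2 w3 : vk_eq w1 w2 -> vk_eq w2 w3 -> vk_eq w1 w3.

Definition cc_letter (c : nat) (l : letter) : letter :=
  if lab l == c then (l.1.1, ~~ l.1.2, ~~ l.2) else l.

Inductive reach : nat -> word -> word -> Prop :=
| reach_eq w w' : vk_eq w w' -> reach 0 w w'
| reach_cc n w w1 c w' :
    vk_eq w w1 -> c \in labels w1 ->
    reach n (map (cc_letter c) w1) w' -> reach n.+1 w w'.

(* The unknot has empty Gauss code. *)
Definition virtually_null_homotopic (K : word) : Prop := exists n, reach n K [::].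
Definition is_vu (K : word) (n : nat) : Prop :=
  reach n K [::] /\ forall m, reach m K [::] -> n <= m.

(* Braid words: (m, true) = classical positive sigma_m, (m, false) = virtual crossing
   at positions m, m+1. *)
Definition gen := (nat * bool)%type.

Definition move_pos (m pos : nat) : nat :=
  if pos == m then m.+1 else if pos == m.+1 then m else pos.

Definition braid_perm (w : seq gen) (pos : nat) : nat :=
  foldl (fun p g => move_pos g.1 p) pos w.

(* Reading the Gauss code along one pass through the braid, starting at position pos;
   the crossing at index t of the braid word gets label t. At sigma_m the strand moving
   from m to m+1 is over. *)
Fixpoint pass (w : seq gen) (t pos : nat) : word * nat :=
  match w with
  | [::] => ([::], pos)
  | g :: w' =>
      let lets := if g.2 && ((pos == g.1) || (pos == g.1.+1))
                  then [:: (t, pos == g.1, true)] else [::] in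
      let r := pass w' t.+1 (move_pos g.1 pos) in
      (lets ++ r.1, r.2)
  end.

Fixpoint passes (w : seq gen) (n pos : nat) : word :=
  match n with
  | 0 => [::]
  | n'.+1 => (pass w 0 pos).1 ++ passes w n' (pass w 0 pos).2
  end.

Definition closure_code (i : nat) (w : seq gen) : word := passes w i 1.

Definition closure_is_knot (i : nat) (w : seq gen) : Prop :=
  forall p, 1 <= p <= i -> exists r, iter r (braid_perm w) 1 = p.

Definition block (i : nat) (cl : bool) : seq gen := [seq (m, cl) | m <- iota 1 i.-1].
Definition VB1 (i j : nat) : seq gen := block i false ++ flatten (nseq j.-1 (block i true)).
Definition Bk (k : nat) : seq gen := [seq (m, true) | m <- rev (iota 1 k)].
Definition braid_ijk (i j k : nat) : seq gen := VB1 i j ++ Bk k.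
Definition diag_ijk (i j k : nat) : word := closure_code i (braid_ijk i j k).

(* Main.v *)
Require Import Defs.
From mathcomp Require Import all_boot all_order all_algebra.
From mathcomp Require Import zify.
Set Implicit Arguments. Unset Strict Implicit. Unset Printing Implicit Defensive.
Import GRing.Theory.

(* Lower bound: give a letter of the Gauss code the value +1 if it is an overpass at a positive
   or an underpass at a negative crossing, and -1 otherwise.  These values survive crossing
   changes, and up to sign the index of a crossing is their sum between its two visits.  The sum
   of the signs of the crossings of nonzero index is invariant under the Reidemeister moves, and
   a crossing change alters it by 0 or 2.  In the diagram (i,j,k) all crossings are positive, and
   the index of a crossing of the r-th and the s-th pass through the braid is r - s up to sign:
   in the classical part the values are the downward displacements of the strand, while the
   virtual block moves each pass but the first one step up.

   Upper bound: start at the virtual overstrand and change the crossings at which the earlier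
   pass runs under the later one.  The result is a closed braid whose passes lie in layers, so it
   is determined by the order in which the passes end.  A crossing of passes r and s at the end
   of the braid slides around the closure to a crossing of passes r + 1 and s + 1 at the start,
   hence this order can be permuted freely; in decreasing order no crossing is left.  As all
   indices are nonzero, the vanishing of the invariant on this unknot shows that exactly half of
   the crossings were changed. *)

(** * Crossings of nonzero index *)

Section Invariant.
Local Open Scope ring_scope.

Definition sgn (b : bool) : int := if b then 1 else -1.
Definition dir (l : letter) : int := sgn (l.1.2 == l.2).
Definition height (w : word) : int := \sum_(l <- w) dir l.

(* [b] records whether the visits of [c] passed so far are odd in number. *)
Fixpoint chord_index (c : nat) (b : bool) (w : word) : int :=
  if w is l :: w' then
    if lab l == c then chord_index c (~~ b) w'
    else (if b then dir l else 0) + chord_index c b w'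
  else 0.

(* The sum runs over letters, so every crossing counts twice. *)
Definition index_writhe (w : word) : int :=
  \sum_(l <- w) (if chord_index (lab l) false w == 0 then 0 else sgn l.2).

(** Gauss codes of closed braids satisfy this condition. It makes the total height vanish, on which
    invariance under rotation of the code rests. *)
Definition well_paired (w : word) : Prop := forall c,
  (count_mem c (labels w) \in [:: 0%N; 2]) && (\sum_(l <- w | lab l == c) dir l == 0).

Lemma height_cat u v : height (u ++ v) = height u + height v.
Proof. by rewrite /height big_cat. Qed.

Lemma labels_cat u v : labels (u ++ v) = labels u ++ labels v.
Proof. exact: map_cat. Qed.

Lemma chord_index_cat c b u v :
  chord_index c b (u ++ v) =
  chord_index c b u + chord_index c (b (+) odd (count_mem c (labels u))) v.
Proof.
elim: u b => [|l u IH] b /=; first by rewrite addbF add0r.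
case: eqP => _ /=; rewrite IH ?addrA //.
by rewrite addbN addNb.
Qed.

Lemma chord_index_notin c b u :
  c \notin labels u -> chord_index c b u = if b then height u else 0.
Proof.
rewrite /height; elim: u => [|l u IH] /=; first by rewrite big_nil; case: ifP.
rewrite inE negb_or eq_sym => /andP[/negbTE -> /IH ->].
by rewrite big_cons; case: ifP; rewrite ?addr0.
Qed.

(** The two arcs into which a crossing cuts the knot together contain all letters of the other
    crossings. *)
Lemma chord_index_negb c b u :
  chord_index c (~~ b) u + chord_index c b u = \sum_(l <- u | lab l != c) dir l.
Proof.
elim: u b => [|l u IH] b /=; first by rewrite big_nil.
rewrite big_cons; case: eqP => _ /=; first by rewrite IH.
rewrite -(IH b); case: b => /=; lia.
Qed.

Lemma well_paired_perm w w' : perm_eq w w' -> well_paired w -> well_paired w'.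
Proof.
move=> pw wp c; move: (wp c); rewrite (perm_big _ pw) /=.
by have /permP -> : perm_eq (labels w) (labels w') by apply: perm_map.
Qed.

Lemma sum_label_notin c u :
  c \notin labels u -> \sum_(l <- u | lab l == c) dir l = 0.
Proof.
move=> cu; rewrite big_seq_cond big1 // => l /andP[lu /eqP lc].
by rewrite -lc map_f in cu.
Qed.

(** The labels of [p] are fresh, so each label is tested either on [u] alone or on [p] alone. *)
Lemma well_paired_cat u p :
  (forall c, c \in labels p -> c \notin labels u) -> well_paired p ->
  well_paired u <-> well_paired (u ++ p).
Proof.
move=> fr wp; have wu c :
    (count_mem c (labels (u ++ p)) \in [:: 0%N; 2])
      && (\sum_(l <- u ++ p | lab l == c) dir l == 0)
  = (count_mem c (labels u) \in [:: 0%N; 2]) && (\sum_(l <- u | lab l == c) dir l == 0).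
  rewrite labels_cat count_cat big_cat /=.
  have [cp|cp] := boolP (c \in labels p).
    have cu := fr c cp.
    by rewrite (count_memPn cu) (sum_label_notin cu) !add0r add0n eqxx wp.
  by rewrite (count_memPn cp) (sum_label_notin cp) addr0 addn0.
by split=> wpu c; move: (wpu c); rewrite wu.
Qed.

Lemma well_paired_pair c o s : well_paired [:: (c, o, s); (c, ~~ o, s)].
Proof.
move=> d; rewrite /= !big_cons big_nil /lab /=.
by case: eqP => _ //; case: o; case: s.
Qed.

(** Grouping the letters by label splits the height into sums that vanish one by one. *)
Lemma well_paired_height w : well_paired w -> height w = 0.
Proof.
move=> wp; rewrite /height.
have -> : \sum_(l <- w) dir l =
    \sum_(l <- w) \sum_(d <- undup (labels w) | lab l == d) dir l.
  rewrite !big_seq; apply: eq_bigr => l lw.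
  rewrite -big_filter (_ : [seq d <- _ | _] = [:: lab l]) ?big_seq1 //.
  have ld : lab l \in undup (labels w) by rewrite mem_undup map_f.
  rewrite -(filter_pred1_uniq (undup_uniq _) ld).
  by apply: eq_filter => d; rewrite /= eq_sym.
rewrite (exchange_big_dep xpredT) //= big1 // => d _.
by have /andP[_ /eqP] := wp d.
Qed.

Lemma index_writhe_eq w (J : nat -> bool) :
  (forall c, c \in labels w -> (chord_index c false w == 0) = J c) ->
  index_writhe w = \sum_(l <- w) (if J (lab l) then 0 else sgn l.2).
Proof.
move=> h; rewrite /index_writhe !big_seq; apply: eq_bigr => l lw.
by rewrite h // map_f.
Qed.

(** Common frame for R1 and R2: [p] collects the letters created by the move. *)
Lemma index_writhe_add w u p :
  perm_eq w (u ++ p) ->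
  (forall c, c \in labels u ->
     (chord_index c false w == 0) = (chord_index c false u == 0)) ->
  \sum_(l <- p) (if chord_index (lab l) false w == 0 then 0 else sgn l.2) = 0 ->
  index_writhe w = index_writhe u.
Proof.
move=> pw hu hp; rewrite /index_writhe (perm_big _ pw) big_cat /= hp addr0.
by rewrite !big_seq; apply: eq_bigr => l lu; rewrite hu // map_f.
Qed.

(** Only the index of the crossing of [a] is affected: its arc is exchanged for the complementary
    one. The heights of the two arcs add up to 0, so this index just changes sign. *)
Lemma index_writhe_rot a w : well_paired (a :: w) ->
  index_writhe (rcons w a) = index_writhe (a :: w).
Proof.
have pw : perm_eq (rcons w a) (a :: w) by rewrite perm_rcons.
move=> wp; rewrite /index_writhe (perm_big _ pw) /=.
apply: eq_bigr => l _; congr (if _ then _ else _).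
rewrite -cats1 chord_index_cat /=.
have := wp (lab l); rewrite !inE /= => /andP[ct /eqP hs].
have h0 := well_paired_height wp.
case: (lab a =P lab l) ct hs => [al|al] ct hs; last first.
  have -> : odd (count_mem (lab l) (labels w)) = false.
    by move: ct; rewrite add0n => /orP[] /eqP ->.
  by rewrite addr0 add0r.
rewrite addr0 -[in RHS]al.
have := chord_index_negb (lab a) false w; rewrite al /=.
have -> : \sum_(l0 <- w | lab l0 != lab l) dir l0 = 0.
  move: h0 hs; rewrite /height !big_cons /= al eqxx.
  rewrite (bigID (fun l0 => lab l0 == lab l)) /= => + hs.
  by rewrite addrA hs add0r.
by move=> h; apply/eqP/eqP; lia.
Qed.

(** * Invariance under the Reidemeister moves *)

Lemma perm_insert2 (T : eqType) (u p v q z : seq T) :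
  perm_eq (u ++ p ++ v ++ q ++ z) ((u ++ v ++ z) ++ p ++ q).
Proof. by apply/permP => P; rewrite !count_cat; lia. Qed.

Lemma height_pair c1 b1 s1 c2 b2 s2 :
  height [:: (c1, b1, s1); (c2, b2, s2)] = sgn (b1 == s1) + sgn (b2 == s2).
Proof. by rewrite /height !big_cons big_nil addr0. Qed.

(** The visits of the new crossing are adjacent, so its index is 0. For any other crossing both new
    letters lie on the same arc, where their values cancel. *)
Lemma R1_invariant u v c b s : c \notin labels (u ++ v) ->
  let w := u ++ [:: (c, b, s); (c, ~~ b, s)] ++ v in
  (well_paired (u ++ v) <-> well_paired w) /\ index_writhe w = index_writhe (u ++ v).
Proof.
move=> cf w; pose p : word := [:: (c, b, s); (c, ~~ b, s)].
have pw : perm_eq w ((u ++ v) ++ p) by rewrite /w -catA perm_cat2l perm_catC.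
split.
  rewrite (@well_paired_cat (u ++ v) p); last exact: well_paired_pair.
    by split; apply: well_paired_perm; rewrite // perm_sym.
  by move=> d; rewrite !inE /lab /= orbb => /eqP ->.
have [cu cv] : c \notin labels u /\ c \notin labels v.
  by apply/norP; rewrite -mem_cat -labels_cat.
apply: (index_writhe_add pw) => [d du|].
  have dc : c == d = false by apply: contraNF cf => /eqP ->.
  rewrite /w !chord_index_cat /= /lab /= dc /=.
  by rewrite addbF; case: (odd _); rewrite /dir /=; case: (b); case: (s); rewrite /= ?add0r.
have cw : chord_index c false w = 0.
  rewrite /w !chord_index_cat /= /lab /= eqxx /= !chord_index_notin //.
  by rewrite (count_memPn cu) /= !addr0.
by rewrite big1_seq // => l /=; rewrite !inE => /orP[] /eqP ->; rewrite /lab /= cw.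
Qed.

(** The new crossings have equal indices and opposite signs, so their contributions cancel. Each
    inserted pair of letters has height 0, which leaves the other indices unchanged. *)
Lemma R2_invariant u1 u2 u3 a b o s sw :
  a != b -> a \notin labels (u1 ++ u2 ++ u3) -> b \notin labels (u1 ++ u2 ++ u3) ->
  let w := u1 ++ [:: (a, o, s); (b, o, ~~ s)] ++ u2 ++
           (if sw then [:: (b, ~~ o, ~~ s); (a, ~~ o, s)]
                  else [:: (a, ~~ o, s); (b, ~~ o, ~~ s)]) ++ u3 in
  (well_paired (u1 ++ u2 ++ u3) <-> well_paired w) /\
  index_writhe w = index_writhe (u1 ++ u2 ++ u3).
Proof.
move=> /negbTE ab af bf w; pose p : word := [:: (a, o, s); (b, o, ~~ s)].
pose q : word := if sw then [:: (b, ~~ o, ~~ s); (a, ~~ o, s)]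
                 else [:: (a, ~~ o, s); (b, ~~ o, ~~ s)].
have wE : w = u1 ++ p ++ u2 ++ q ++ u3 by [].
have ba : b == a = false by rewrite eq_sym.
have pw : perm_eq w ((u1 ++ u2 ++ u3) ++ p ++ q) by exact: perm_insert2.
split.
  rewrite (@well_paired_cat (u1 ++ u2 ++ u3) (p ++ q)).
  - by split; apply: well_paired_perm; rewrite // perm_sym.
  - by move=> d; rewrite /q; case: (sw); rewrite !inE /lab /= => /or4P[] /eqP ->.
  have wa := @well_paired_pair a o s; have wb := @well_paired_pair b o (~~ s).
  have pq : perm_eq ([:: (a, o, s); (a, ~~ o, s)] ++ [:: (b, o, ~~ s); (b, ~~ o, ~~ s)])
                    (p ++ q).
    by apply/permP => P; rewrite /q; case: (sw); rewrite /= ; lia.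
  apply: (well_paired_perm pq); apply: (proj1 (well_paired_cat _ wb) wa) => d.
  by rewrite !inE /lab /= !orbb => /eqP ->; rewrite ba.
move: af bf; rewrite !labels_cat !mem_cat !negb_or.
move=> /and3P[a1 a2 a3] /and3P[b1 b2 b3].
have hp : height p = 0.
  by rewrite /p height_pair; case: (o); case: (s).
have hq : height q = 0.
  by rewrite /q; case: (sw); rewrite height_pair; case: (o); case: (s).
apply: (index_writhe_add pw) => [d du|].
  have [ad bd] : d != a /\ d != b.
    move: du; rewrite !labels_cat !mem_cat => du.
    by split; apply: contraTneq du => ->; rewrite !negb_or; apply/and3P.
  have [dp dq] : d \notin labels p /\ d \notin labels q.
    by rewrite /q; case: (sw); rewrite !inE /lab /= !negb_or ad bd.
  rewrite wE !chord_index_cat !(chord_index_notin _ dp) !(chord_index_notin _ dq) hp hq.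
  by rewrite (count_memPn dp) (count_memPn dq) /= !addbF !if_same !add0r.
have E : chord_index a false w = chord_index b false w.
  rewrite wE /p /q !chord_index_cat.
  rewrite !(chord_index_notin _ a1, chord_index_notin _ a2, chord_index_notin _ a3).
  rewrite !(chord_index_notin _ b1, chord_index_notin _ b2, chord_index_notin _ b3).
  rewrite (count_memPn a1) (count_memPn b1) (count_memPn a2) (count_memPn b2).
  by case: (sw); rewrite /= /lab /= ?(eqxx, ab, ba) /= ?(eqxx, ab, ba) /dir /=;
    case: (o); case: (s); rewrite /sgn /=; lia.
rewrite /p /q; case: (sw); rewrite /= !big_cons big_nil /lab /= E; case: ifP => // _; 
  by case: (s).
Qed.

Lemma height_perm w w' : perm_eq w w' -> height w = height w'.
Proof. by move=> pw; rewrite /height (perm_big _ pw). Qed.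

Definition r3word (u0 u1 u2 u3 : word) (p0 p1 p2 : nat) (arc : nat -> word) : word :=
  u0 ++ arc p0 ++ u1 ++ arc p1 ++ u2 ++ arc p2 ++ u3.

Lemma r3arc_perm e12 e13 e23 r1 r2 r3 x y z t :
  perm_eq (r3arc e12 e13 e23 r1 r2 r3 x y z false t)
          (r3arc e12 e13 e23 r1 r2 r3 x y z true t).
Proof.
by case: t => [|[|t]] /=; rewrite ?addbT ?addbF;
  case: (r1); case: (r2); case: (r3); rewrite /= ?perm_refl //;
  apply/permP => P /=; lia.
Qed.

Lemma r3arc_labels e12 e13 e23 r1 r2 r3 x y z af t c : c \notin [:: x; y; z] ->
  c \notin labels (r3arc e12 e13 e23 r1 r2 r3 x y z af t).
Proof.
rewrite !inE !negb_or => /and3P[/negbTE cx /negbTE cy /negbTE cz].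
by case: t => [|[|t]] /=; rewrite /oriented; case: ifP; rewrite !inE /lab /= ?cx ?cy ?cz.
Qed.

(** On the arcs of an R3 move the over/under bit [e] enters the sign as well and cancels: the value
    of a letter depends only on the orientations of the two strands. *)
Lemma dirE1 e q : (e == e (+) q) = ~~ q.
Proof. by case: e; case: q. Qed.
Lemma dirE2 e q : (~~ e == e (+) q) = q.
Proof. by case: e; case: q. Qed.

Lemma perm3_cases p0 p1 p2 : perm_eq [:: p0; p1; p2] [:: 0; 1; 2]%N ->
  [:: p0; p1; p2] \in [:: [:: 1; 0; 2]; [:: 0; 1; 2]; [:: 2; 0; 1];
                          [:: 0; 2; 1]; [:: 1; 2; 0]; [:: 2; 1; 0]]%N.
Proof. by rewrite -mem_permutations. Qed.

(** A finite check over the crossing, the order of the arcs and the orientations, with the heights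
    of the four outer pieces kept as unknowns. *)
Lemma r3_chord_index u0 u1 u2 u3 e12 e13 e23 r1 r2 r3 x y z p0 p1 p2 :
  uniq [:: x; y; z] -> perm_eq [:: p0; p1; p2] [:: 0; 1; 2]%N ->
  all (fun c => c \notin labels (u0 ++ u1 ++ u2 ++ u3)) [:: x; y; z] ->
  forall c, c \in [:: x; y; z] ->
  chord_index c false (r3word u0 u1 u2 u3 p0 p1 p2
    (r3arc e12 e13 e23 r1 r2 r3 x y z false)) =
  chord_index c false (r3word u0 u1 u2 u3 p0 p1 p2
    (r3arc e12 e13 e23 r1 r2 r3 x y z true)).
Proof.
rewrite /= !inE !negb_or !andbT => /andP[/andP[/negbTE xy /negbTE xz] /negbTE yz].
have [yx zx zy] : [/\ (y == x) = false, (z == x) = false & (z == y) = false].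
  by rewrite ![_ == x]eq_sym [z == y]eq_sym.
move=> pp /and3P[fx fy fz] c ci.
have cu : c \notin labels (u0 ++ u1 ++ u2 ++ u3).
  by move: ci; rewrite !inE => /or3P[] /eqP ->.
move: cu; rewrite !labels_cat !mem_cat !negb_or => /and4P[c0 c1 c2 c3].
rewrite /r3word !chord_index_cat.
rewrite !(chord_index_notin _ c0, chord_index_notin _ c1, chord_index_notin _ c2,
  chord_index_notin _ c3) (count_memPn c0) (count_memPn c1) (count_memPn c2) {c0 c1 c2 c3 fx fy fz}.
move: (height u0) (height u1) (height u2) (height u3) => S0 S1 S2 S3.
have := perm3_cases pp.
move: ci; rewrite !inE => /or3P[] /eqP ->;
 case/or4P => [||| /or3P[]] /eqP [-> -> ->] /=; rewrite /oriented ?addbT ?addbF.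
all: (case: r1; case: r2; case: r3 => /=;
 rewrite /lab /= ?(eqxx, xy, xz, yz, yx, zx, zy) /=
   ?(eqxx, xy, xz, yz, yx, zx, zy) /= /dir /= ?dirE1 ?dirE2 /sgn /=).
all: lia.
Qed.

(** A crossing outside the triangle sees each arc as one block, whose height does not depend on the
    order of its letters. *)
Lemma R3_invariant u0 u1 u2 u3 e12 e13 e23 r1 r2 r3 x y z p0 p1 p2 :
  uniq [:: x; y; z] -> perm_eq [:: p0; p1; p2] [:: 0; 1; 2]%N ->
  all (fun c => c \notin labels (u0 ++ u1 ++ u2 ++ u3)) [:: x; y; z] ->
  let w := r3word u0 u1 u2 u3 p0 p1 p2 (r3arc e12 e13 e23 r1 r2 r3 x y z false) in
  let w' := r3word u0 u1 u2 u3 p0 p1 p2 (r3arc e12 e13 e23 r1 r2 r3 x y z true) in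
  (well_paired w <-> well_paired w') /\ index_writhe w' = index_writhe w.
Proof.
move=> ux pp fr w w'.
have pw : perm_eq w w'.
  by rewrite /w /w' /r3word; do 3! [rewrite perm_cat2l; apply: perm_cat; first exact: r3arc_perm].
split; first by split; apply: well_paired_perm; rewrite // perm_sym.
rewrite /index_writhe (perm_big _ pw) /=; apply: eq_bigr => l _.
congr (if _ == 0 then _ else _); move: (lab l) => c {l}.
have [cx|cx] := boolP (c \in [:: x; y; z]); first by rewrite (r3_chord_index _ _ _ _ _ _ ux pp fr).
rewrite /w /w' /r3word !chord_index_cat.
have H t b : chord_index c b (r3arc e12 e13 e23 r1 r2 r3 x y z true t) =
             chord_index c b (r3arc e12 e13 e23 r1 r2 r3 x y z false t).
  rewrite !chord_index_notin ?r3arc_labels //.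
  by rewrite (height_perm (r3arc_perm _ _ _ _ _ _ _ _ _ _)).
have C t : count_mem c (labels (r3arc e12 e13 e23 r1 r2 r3 x y z true t)) =
           count_mem c (labels (r3arc e12 e13 e23 r1 r2 r3 x y z false t)).
  by rewrite !(count_memPn _) ?r3arc_labels.
by rewrite !H !C.
Qed.

(** The first part is an equivalence because steps may also be taken backwards. *)
Lemma vk_eq_invariant w w' : vk_eq w w' ->
  (well_paired w <-> well_paired w') /\ (well_paired w -> index_writhe w' = index_writhe w).
Proof.
elim=> {w w'} [w|w w' s|w w' _ [h1 h2]|w1 w2 w3 _ [h1 h2] _ [h3 h4]] //.
- case: s => {w w'} [a w|u v c b s cf|u1 u2 u3 a b o s sw ab af bf|
    u0 u1 u2 u3 e12 e13 e23 r1 r2 r3 x y z p0 p1 p2 _ _ ux pp fr].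
  + split; last exact: index_writhe_rot.
    by split; apply: well_paired_perm; rewrite ?perm_rcons // perm_sym perm_rcons.
  + by have [h1 h2] := R1_invariant b s cf.
  + by have [h1 h2] := R2_invariant o s sw ab af bf.
  + by have [h1 h2] := R3_invariant e12 e13 e23 r1 r2 r3 ux pp fr.
- by split=> [|/h1 /h2 ->]; first split=> /h1.
- by split=> [|wp]; [rewrite h1 | rewrite h4 ?h2 -?h1].
Qed.

(** * Effect of crossing changes *)

Lemma cc_lab c l : lab (cc_letter c l) = lab l.
Proof. by rewrite /cc_letter; case: eqP. Qed.

Lemma cc_dir c l : dir (cc_letter c l) = dir l.
Proof.
by rewrite /cc_letter; case: eqP => // _; case: l => [[a b] d]; rewrite /dir /=; case: b; case: d.
Qed.

Lemma cc_labels c w : labels (map (cc_letter c) w) = labels w.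
Proof. by rewrite /labels -map_comp; apply: eq_map => l /=; rewrite cc_lab. Qed.

Lemma cc_chord_index c d b w : chord_index d b (map (cc_letter c) w) = chord_index d b w.
Proof. by elim: w b => //= l w IH b; rewrite cc_lab cc_dir !IH. Qed.

Lemma cc_well_paired c w : well_paired w -> well_paired (map (cc_letter c) w).
Proof.
move=> wp d; move: (wp d); rewrite cc_labels big_map.
rewrite (eq_bigl (fun l => lab l == d)) => [|l]; last by rewrite cc_lab.
by under [X in _ -> _ && (X == _)]eq_bigr do rewrite cc_dir.
Qed.

(** All indices persist, so only the at most two letters of [c] contribute, each by 0 or 2 in
    absolute value. *)
Lemma cc_index_writhe c w : well_paired w ->
  `|index_writhe w - index_writhe (map (cc_letter c) w)| <= 4.
Proof.
move=> wp; rewrite /index_writhe big_map -sumrB.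
rewrite (bigID (fun l => lab l == c)) /= [X in _ + X]big1 ?addr0; last first.
  by move=> l lc; rewrite cc_lab cc_chord_index /cc_letter (negbTE lc) subrr.
have /andP[ct _] := wp c.
apply: (@Order.POrderTheory.le_trans _ _ (\sum_(l <- w | lab l == c) 2)).
  apply: (Order.POrderTheory.le_trans (Num.Theory.ler_norm_sum _ _ _)).
  apply: Num.Theory.ler_sum => l lc.
  rewrite cc_lab cc_chord_index /cc_letter lc /=.
  by case: ifP => _; rewrite ?subrr //; case: (l.2).
rewrite big_const_seq iter_addr_0.
move: ct; rewrite count_map (eq_count (a2 := fun l => lab l == c)) //.
by rewrite !inE => /orP[] /eqP ->.
Qed.

Lemma reach_index_writhe n w w' : reach n w w' -> well_paired w ->
  `|index_writhe w - index_writhe w'| <= (4 * n)%:Z.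
Proof.
elim=> {n w w'} [w w' e|n w w1 c w' e _ _ IH] wp.
  by rewrite (vk_eq_invariant e).2 // subrr.
have [h1 h2] := vk_eq_invariant e.
have wp1 := h1.1 wp; have := IH (cc_well_paired c wp1).
by have := cc_index_writhe c wp1; rewrite (h2 wp); lia.
Qed.
End Invariant.

(** * Gauss codes of closed braids *)

(* [(t, a, b)]: at the crossing labelled [t] the pass [a] moves down and the pass [b] moves up;
   [ov a b] tells whether [a] is over.  Passes are numbered in the order of traversal. *)
Definition event := (nat * nat * nat)%type.
Definition upper_letter (ov : rel nat) (e : event) : letter :=
  (e.1.1, ov e.1.2 e.2, ov e.1.2 e.2).
Definition lower_letter (ov : rel nat) (e : event) : letter :=
  (e.1.1, ~~ ov e.1.2 e.2, ov e.1.2 e.2).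
Definition event_letters (ov : rel nat) (r : nat) (e : event) : word :=
  if r == e.1.2 then [:: upper_letter ov e]
  else if r == e.2 then [:: lower_letter ov e] else [::].
Definition strand (ov : rel nat) (r : nat) (E : seq event) : word :=
  flatten (map (event_letters ov r) E).
Definition strands (ov : rel nat) (p q : nat) (E : seq event) : word :=
  flatten [seq strand ov r E | r <- iota p (q - p)].
Definition gauss (ov : rel nat) (n : nat) (E : seq event) : word := strands ov 0 n E.
Definition elabels (E : seq event) : seq nat := [seq e.1.1 | e <- E].

Lemma strand_cat ov r E E' : strand ov r (E ++ E') = strand ov r E ++ strand ov r E'.
Proof. by rewrite /strand map_cat flatten_cat. Qed.

Lemma strands_split ov p q r E : p <= r < q ->
  strands ov p q E = strands ov p r E ++ strand ov r E ++ strands ov r.+1 q E.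
Proof.
move=> prq; rewrite /strands.
have -> : q - p = (r - p) + (1 + (q - r.+1)) by lia.
rewrite iotaD map_cat flatten_cat; congr (_ ++ _).
by rewrite subnKC ?addn1 //; lia.
Qed.

Lemma eq_strands ov p q E E' :
  (forall r, p <= r < q -> strand ov r E = strand ov r E') ->
  strands ov p q E = strands ov p q E'.
Proof.
by move=> h; congr flatten; apply/eq_in_map => r; rewrite mem_iota => ?; apply: h; lia.
Qed.

Lemma labels_strand ov r E : {subset labels (strand ov r E) <= elabels E}.
Proof.
elim: E => [|e E IH] c //; rewrite /strand /= labels_cat mem_cat inE => /orP[|/IH ->].
  rewrite /event_letters; case: ifP => _; last case: ifP => _ //.
    by rewrite inE => /eqP ->; rewrite eqxx.
  by rewrite inE => /eqP ->; rewrite eqxx.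
by rewrite orbT.
Qed.

Lemma labels_strands ov p q E : {subset labels (strands ov p q E) <= elabels E}.
Proof.
move=> c; rewrite /strands; elim: (iota _ _) => //= r s IH.
by rewrite labels_cat mem_cat => /orP[/labels_strand|].
Qed.

Lemma elabels_cat E E' : elabels (E ++ E') = elabels E ++ elabels E'.
Proof. exact: map_cat. Qed.

Lemma strand_mid ov r E1 X E2 :
  strand ov r X = [::] -> strand ov r (E1 ++ X ++ E2) = strand ov r (E1 ++ E2).
Proof. by move=> h; rewrite !strand_cat h. Qed.

(** Isolates a piece [X] of the braid that meets only the passes [a] and [b]. The surrounding words
    do not mention [X], as the moves on Gauss codes require. *)
Lemma gauss_split2 ov n a b E1 X E2 : a < b < n ->
  (forall r, r != a -> r != b -> strand ov r X = [::]) ->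
  gauss ov n (E1 ++ X ++ E2) =
  (strands ov 0 a (E1 ++ E2) ++ strand ov a E1) ++ strand ov a X ++
  (strand ov a E2 ++ strands ov a.+1 b (E1 ++ E2) ++ strand ov b E1) ++ strand ov b X ++
  (strand ov b E2 ++ strands ov b.+1 n (E1 ++ E2)).
Proof.
move=> abn h; rewrite /gauss (@strands_split ov 0 n a); last by lia.
rewrite (@strands_split ov a.+1 n b); last by lia.
rewrite (@eq_strands ov 0 a _ (E1 ++ E2)); last by move=> r ?; rewrite strand_mid // h //; lia.
rewrite (@eq_strands ov a.+1 b _ (E1 ++ E2)); last by move=> r ?; rewrite strand_mid // h //; lia.
rewrite (@eq_strands ov b.+1 n _ (E1 ++ E2)); last by move=> r ?; rewrite strand_mid // h //; lia.
by rewrite !strand_cat -!catA.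
Qed.

Lemma gauss_split3 ov n a b c E1 X E2 : a < b -> b < c < n ->
  (forall r, r != a -> r != b -> r != c -> strand ov r X = [::]) ->
  gauss ov n (E1 ++ X ++ E2) =
  (strands ov 0 a (E1 ++ E2) ++ strand ov a E1) ++ strand ov a X ++
  (strand ov a E2 ++ strands ov a.+1 b (E1 ++ E2) ++ strand ov b E1) ++ strand ov b X ++
  (strand ov b E2 ++ strands ov b.+1 c (E1 ++ E2) ++ strand ov c E1) ++ strand ov c X ++
  (strand ov c E2 ++ strands ov c.+1 n (E1 ++ E2)).
Proof.
move=> ab bcn h; rewrite /gauss (@strands_split ov 0 n a); last by lia.
rewrite (@strands_split ov a.+1 n b); last by lia.
rewrite (@strands_split ov b.+1 n c); last by lia.
rewrite (@eq_strands ov 0 a _ (E1 ++ E2)); last by move=> r ?; rewrite strand_mid // h //; lia.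
rewrite (@eq_strands ov a.+1 b _ (E1 ++ E2)); last by move=> r ?; rewrite strand_mid // h //; lia.
rewrite (@eq_strands ov b.+1 c _ (E1 ++ E2)); last by move=> r ?; rewrite strand_mid // h //; lia.
rewrite (@eq_strands ov c.+1 n _ (E1 ++ E2)); last by move=> r ?; rewrite strand_mid // h //; lia.
by rewrite !strand_cat -!catA.
Qed.

Lemma labels_around ov P E1 E2 : (forall w, w \in P ->
    (exists r, w = strand ov r E1) \/ (exists r, w = strand ov r E2) \/
    (exists p q, w = strands ov p q (E1 ++ E2))) ->
  {subset labels (flatten P) <= elabels (E1 ++ E2)}.
Proof.
move=> h c; elim: P h => //= w P IH h; rewrite labels_cat mem_cat => /orP[cw|]; last first.
  by apply: IH => v vP; apply: h; rewrite inE vP orbT.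
have [[r E]|[[r E]|[p [q E]]]] := h w (mem_head _ _); rewrite {}E in cw.
- by rewrite elabels_cat mem_cat (labels_strand cw).
- by rewrite elabels_cat mem_cat (labels_strand cw) orbT.
- exact: labels_strands cw.
Qed.

(** * Reidemeister moves between layered passes *)

Lemma strand_pair ov r (e e' : event) :
  strand ov r [:: e; e'] = event_letters ov r e ++ event_letters ov r e'.
Proof. by rewrite /strand /= cats0. Qed.

Lemma fresh_around2 ov n c p q E1 E2 : c \notin elabels (E1 ++ E2) ->
  c \notin labels ((strands ov 0 p (E1 ++ E2) ++ strand ov p E1) ++
   (strand ov p E2 ++ strands ov p.+1 q (E1 ++ E2) ++ strand ov q E1) ++
   (strand ov q E2 ++ strands ov q.+1 n (E1 ++ E2))).
Proof.
apply: contra => h.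
apply: (@labels_around ov [:: strands ov 0 p (E1 ++ E2); strand ov p E1; strand ov p E2;
   strands ov p.+1 q (E1 ++ E2); strand ov q E1; strand ov q E2;
   strands ov q.+1 n (E1 ++ E2)]).
  by move=> w; rewrite !inE => /or4P[|||/or4P[]] /eqP ->; eauto 6.
by rewrite /= cats0 -!catA in h *.
Qed.

(** Under [ltn] the earlier pass is over at both crossings, which therefore have opposite signs.
    Both passes run left to right and meet the crossings in the same order, hence the flag [false]
    for [sw]. *)
Lemma gauss_R2 n E1 E2 x y a b : a < n -> b < n -> a != b ->
  uniq (x :: y :: elabels (E1 ++ E2)) ->
  vk_eq (gauss ltn n (E1 ++ [:: (x, a, b); (y, b, a)] ++ E2)) (gauss ltn n (E1 ++ E2)).
Proof.
move=> an bn ab /=; rewrite inE negb_or => /andP[/andP[xy xE] /andP[yE _]].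
apply: vk_sym.
have fresh c p q := @fresh_around2 ltn n c p q E1 E2.
have other r : r != a -> r != b -> strand ltn r [:: (x, a, b); (y, b, a)] = [::].
  by move=> /negbTE ra /negbTE rb; rewrite strand_pair /event_letters /= ra rb.
have ba : b == a = false by rewrite eq_sym; apply/negbTE.
have [sa sb] : strand ltn a [:: (x, a, b); (y, b, a)] = [:: (x, a < b, a < b); (y, a < b, b < a)]
   /\ strand ltn b [:: (x, a, b); (y, b, a)] = [:: (x, b < a, a < b); (y, b < a, b < a)].
  rewrite !strand_pair /event_letters /= !eqxx (negbTE ab) ba /upper_letter /lower_letter /=.
  by case: (ltngtP a b) ab => //= ->; rewrite eqxx.
case: (ltngtP a b) sa sb => [lt|lt|eq] sa sb; last by rewrite eq eqxx in ab.
- rewrite (@gauss_split2 ltn n a b E1 [:: (x, a, b); (y, b, a)]) ?lt // sa sb.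
  rewrite (@gauss_split2 ltn n a b E1 [::]) ?lt //.
  exact: vk_step (gs_R2 true true false xy (fresh x a b xE) (fresh y a b yE)).
- rewrite (@gauss_split2 ltn n b a E1 [:: (x, a, b); (y, b, a)]) ?lt //; last by auto.
  rewrite sa sb (@gauss_split2 ltn n b a E1 [::]) ?lt //.
  exact: vk_step (gs_R2 true false false xy (fresh x b a xE) (fresh y b a yE)).
Qed.

Section R3.
Variables (n x y z a b c : nat) (E1 E2 : seq event).
Hypotheses (an : a < n) (bn : b < n) (cn : c < n) (ab : a != b) (ac : a != c) (bc : b != c).
Hypothesis fr : uniq ([:: x; y; z] ++ elabels (E1 ++ E2)).

Let X := [:: (x, a, b); (y, a, c); (z, b, c)].
Let X' := [:: (z, b, c); (y, a, c); (x, a, b)].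
Let arc := r3arc (a < b) (a < c) (b < c) false false false x y z.

Lemma strand_R3 t : t < 3 ->
  strand ltn (nth 0 [:: a; b; c] t) X = arc false t /\
  strand ltn (nth 0 [:: a; b; c] t) X' = arc true t.
Proof.
move=> t3; rewrite /strand /X /X' /arc /r3arc !addbF /event_letters /=.
have [ba ca cb] : [/\ (b == a) = false, (c == a) = false & (c == b) = false].
  by rewrite ![_ == a]eq_sym [c == b]eq_sym; split; apply/negbTE.
by move: t3; case: t => [|[|[|]]] //= _;
  rewrite ?eqxx ?(negbTE ab) ?(negbTE ac) ?(negbTE bc) ?ba ?ca ?cb.
Qed.

(** [p0], [p1], [p2] list the three strands in the order in which the code traverses them. *)
Lemma gauss_R3_sorted p0 p1 p2 : perm_eq [:: p0; p1; p2] [:: 0; 1; 2] ->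
  nth 0 [:: a; b; c] p0 < nth 0 [:: a; b; c] p1 < nth 0 [:: a; b; c] p2 ->
  vk_eq (gauss ltn n (E1 ++ X ++ E2)) (gauss ltn n (E1 ++ X' ++ E2)).
Proof.
move=> pp.
have p3 p : p \in [:: p0; p1; p2] -> p < 3.
  by rewrite (perm_mem pp) !inE => /or3P[] /eqP ->.
have bound p : p < 3 -> nth 0 [:: a; b; c] p < n by case: p => [|[|[|]]].
have n2 : nth 0 [:: a; b; c] p2 < n by apply/bound/p3; rewrite !inE eqxx !orbT.
have other r : r != nth 0 [:: a; b; c] p0 -> r != nth 0 [:: a; b; c] p1 ->
   r != nth 0 [:: a; b; c] p2 -> strand ltn r X = [::] /\ strand ltn r X' = [::].
  move=> h0 h1 h2.
  have h : r \notin [:: a; b; c].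
    apply/(nthP 0) => -[p p3' pr].
    have : p \in [:: p0; p1; p2] by rewrite (perm_mem pp); case: p p3' {pr} => [|[|[|]]].
    by rewrite !inE => /or3P[] /eqP e; move: h0 h1 h2; rewrite -e pr eqxx.
  move: h; rewrite !inE !negb_or => /and3P[/negbTE ra /negbTE rb /negbTE rc].
  by rewrite /strand /X /X' /event_letters /= ra rb rc.
have [s0 s0'] := strand_R3 (p3 p0 (mem_head _ _)).
have [s1 s1'] : strand ltn (nth 0 [:: a; b; c] p1) X = arc false p1 /\
  strand ltn (nth 0 [:: a; b; c] p1) X' = arc true p1.
  by apply/strand_R3/p3; rewrite !inE eqxx orbT.
have [s2 s2'] : strand ltn (nth 0 [:: a; b; c] p2) X = arc false p2 /\
  strand ltn (nth 0 [:: a; b; c] p2) X' = arc true p2.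
  by apply/strand_R3/p3; rewrite !inE eqxx !orbT.
move: (nth 0 _ p0) (nth 0 _ p1) (nth 0 _ p2) n2 other s0 s0' s1 s1' s2 s2' =>
  i0 i1 i2 n2 other s0 s0' s1 s1' s2 s2' /andP[lt1 lt2].
rewrite (@gauss_split3 ltn n i0 i1 i2 E1 X) ?lt1 ?lt2 //; last first.
  by move=> r h0 h1 h2; have [] := other r h0 h1 h2.
rewrite (@gauss_split3 ltn n i0 i1 i2 E1 X') ?lt1 ?lt2 //; last first.
  by move=> r h0 h1 h2; have [] := other r h0 h1 h2.
rewrite s0 s0' s1 s1' s2 s2'; apply: vk_step; apply: gs_R3 => //.
(* The two cyclic over/under patterns excluded in R3 would contradict the transitivity of the order
   of passes. *)
- by apply/negP => /and3P[]; lia.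
- by apply/negP => /and3P[]; lia.
- by move: fr; rewrite cat_uniq => /and3P[].
apply/allP => d dx; apply: contraL dx => h.
have dE : d \in elabels (E1 ++ E2).
  apply: (@labels_around ltn [:: strands ltn 0 i0 (E1 ++ E2); strand ltn i0 E1; strand ltn i0 E2;
     strands ltn i0.+1 i1 (E1 ++ E2); strand ltn i1 E1; strand ltn i1 E2;
     strands ltn i1.+1 i2 (E1 ++ E2); strand ltn i2 E1; strand ltn i2 E2;
     strands ltn i2.+1 n (E1 ++ E2)]).
    by move=> w; rewrite !inE => /or4P[|||/or4P[|||/or4P[]]] /eqP ->; eauto 6.
  by rewrite /= cats0 -!catA in h *.
move: fr; rewrite cat_uniq => /and3P[_ /hasPn/(_ d dE) + _]; by [].
Qed.

Lemma gauss_R3 : vk_eq (gauss ltn n (E1 ++ X ++ E2)) (gauss ltn n (E1 ++ X' ++ E2)).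
Proof.
case: (ltngtP a b) ab => // lab _; case: (ltngtP a c) ac => // lac _;
  case: (ltngtP b c) bc => // lbc _; try lia.
- by apply: (@gauss_R3_sorted 0 1 2) => //=; lia.
- by apply: (@gauss_R3_sorted 0 2 1) => //=; lia.
- by apply: (@gauss_R3_sorted 2 0 1) => //=; lia.
- by apply: (@gauss_R3_sorted 1 0 2) => //=; lia.
- by apply: (@gauss_R3_sorted 1 2 0) => //=; lia.
- by apply: (@gauss_R3_sorted 2 1 0) => //=; lia.
Qed.
End R3.

(** Distant crossings share no pass, so their relative order leaves no trace in the code. *)
Lemma gauss_comm ov n E1 E2 x y a b c d :
  a != c -> a != d -> b != c -> b != d ->
  gauss ov n (E1 ++ [:: (x, a, b); (y, c, d)] ++ E2) =
  gauss ov n (E1 ++ [:: (y, c, d); (x, a, b)] ++ E2).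
Proof.
move=> ac ad bc bd; apply: eq_strands => r _; rewrite !strand_cat !strand_pair.
congr (_ ++ (_ ++ _)); rewrite /event_letters /=.
by (do ! [case: eqP => //= ?]); subst; rewrite ?eqxx in ac ad bc bd.
Qed.

(** In the code the end of pass [r] is followed by the start of pass [r.+1], and [ltn] is unchanged
    when both passes are shifted. The bounds keep away from the last pass, whose end meets the start
    of pass 0 only cyclically. *)
Lemma gauss_conj n E t a b : a.+1 < n -> b.+1 < n ->
  gauss ltn n (E ++ [:: (t, a, b)]) = gauss ltn n ((t, a.+1, b.+1) :: E).
Proof.
move=> an bn; rewrite /gauss /strands subn0.
pose g r := event_letters ltn r (t, a, b).
pose g' r := event_letters ltn r (t, a.+1, b.+1).
have gg r : g' r.+1 = g r by rewrite /g /g' /event_letters /upper_letter /lower_letter /= !eqSS.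
have shift m : flatten [seq g' r ++ strand ltn r E | r <- iota 0 m] ++ g' m =
    flatten [seq strand ltn r E ++ g r | r <- iota 0 m].
  elim: m => // m IH; rewrite -addn1 iotaD !map_cat !flatten_cat /= !cats0 -IH !add0n addn1 gg.
  by rewrite -!catA.
have gn : g' n = [::] by rewrite /g' /event_letters /= !gtn_eqF.
rewrite -[RHS]cats0 -gn shift; congr flatten; apply: eq_map => r.
by rewrite strand_cat /strand /= cats0.
Qed.

(** * Untying layered closed braids *)

(* [(t, m)]: the crossing labelled [t] exchanges the positions [m] and [m.+1], counted from 0. *)
Definition crossing := (nat * nat)%type.
Fixpoint swap (T : Type) (m : nat) (L : seq T) : seq T :=
  match m, L with
  | 0, a :: b :: L' => b :: a :: L'
  | m'.+1, a :: L' => a :: swap m' L'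
  | _, _ => L
  end.
Definition act (T : Type) (L : seq T) (B : seq crossing) : seq T :=
  foldl (fun L c => swap c.2 L) L B.
(** [L] records which pass stands at each position, from top to bottom. *)
Fixpoint events (L : seq nat) (B : seq crossing) : seq event :=
  if B is c :: B' then (c.1, nth 0 L c.2, nth 0 L c.2.+1) :: events (swap c.2 L) B'
  else [::].

Lemma swap_cat (T : Type) m (A L : seq T) : swap (size A + m) (A ++ L) = A ++ swap m L.
Proof. by elim: A => //= a A ->. Qed.

Lemma perm_swap (T : eqType) m (L : seq T) : perm_eq (swap m L) L.
Proof.
elim: m L => [|m IH] [|a L] //=; last by rewrite perm_cons.
by case: L => //= b L; apply/permP => P /=; lia.
Qed.

Lemma size_swap (T : Type) m (L : seq T) : size (swap m L) = size L.
Proof. by elim: m L => [|m IH] [|a [|b L]] //=; rewrite ?IH. Qed.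

Lemma swap_split (T : Type) m (L : seq T) : m.+1 < size L ->
  exists A a b C, L = A ++ a :: b :: C /\ size A = m.
Proof.
elim: m L => [|m IH] [|a L] //=; first by case: L => // b L _; exists [::], a, b, L.
by move=> /IH [A [c [d [C [-> <-]]]]]; exists (a :: A), c, d, C.
Qed.

Lemma act_cat (T : Type) (L : seq T) B B' : act L (B ++ B') = act (act L B) B'.
Proof. exact: foldl_cat. Qed.

Lemma perm_act (T : eqType) (L : seq T) B : perm_eq (act L B) L.
Proof.
elim: B L => //= c B IH L; exact: perm_trans (IH _) (perm_swap _ _).
Qed.

Lemma events_cat L B B' : events L (B ++ B') = events L B ++ events (act L B) B'.
Proof. by elim: B L => //= c B IH L; rewrite IH. Qed.

Lemma elabels_events L B : elabels (events L B) = map fst B.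
Proof. by elim: B L => //= c B IH L; rewrite IH. Qed.

Definition shift (s : nat) (B : seq crossing) : seq crossing := [seq (c.1, s + c.2) | c <- B].

Lemma events_shift A L B : events (A ++ L) (shift (size A) B) = events L B.
Proof.
elim: B L => //= c B IH L; rewrite swap_cat IH -addnS !nth_cat.
by rewrite !ltnNge !leq_addr /= !addKn.
Qed.

Lemma act_shift (T : Type) (A L : seq T) B : act (A ++ L) (shift (size A) B) = A ++ act L B.
Proof. by elim: B L => //= c B IH L; rewrite swap_cat IH. Qed.

Lemma map_eq_cat (T U : Type) (f : T -> U) D s1 s2 : map f D = s1 ++ s2 ->
  exists D1 D2, [/\ D = D1 ++ D2, map f D1 = s1 & map f D2 = s2].
Proof.
move=> h; exists (take (size s1) D), (drop (size s1) D).
by rewrite cat_take_drop map_take map_drop h take_size_cat ?drop_size_cat.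
Qed.

(** * The relations of the symmetric group for layered braid words *)

Section Reduction.
Variable n : nat.

(* The context [U], [V] makes the relation a congruence for concatenation. *)
Definition reduces (B B' : seq crossing) : Prop := forall U V L,
  uniq (map fst (U ++ B ++ V)) -> perm_eq L (iota 0 n) ->
  [/\ uniq (map fst (U ++ B' ++ V)), act L B = act L B' &
      vk_eq (gauss ltn n (events L (U ++ B ++ V))) (gauss ltn n (events L (U ++ B' ++ V)))].

Lemma reduces_refl B : reduces B B.
Proof. by move=> U V L *; split => //; apply: vk_refl. Qed.

Lemma reduces_trans B2 B1 B3 : reduces B1 B2 -> reduces B2 B3 -> reduces B1 B3.
Proof.
move=> h1 h2 U V L u p; have [u1 a1 v1] := h1 U V L u p; have [u2 a2 v2] := h2 U V L u1 p.
by split; [|rewrite a1|apply: vk_trans v1 v2].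
Qed.

Lemma reduces_context A B B' C : reduces B B' -> reduces (A ++ B ++ C) (A ++ B' ++ C).
Proof.
move=> h U V L; have := h (U ++ A) (C ++ V); rewrite -!catA => h' u p.
have [u1 _ v1] := h' L u p; split=> //.
rewrite !act_cat; congr act.
by have [] := h' (act L A) u (perm_trans (perm_act _ _) p).
Qed.

Lemma reduces_by B B' :
  (forall s, uniq (map fst B ++ s) -> uniq (map fst B' ++ s)) ->
  (forall L, perm_eq L (iota 0 n) -> act L B = act L B') ->
  (forall L E1 E2, perm_eq L (iota 0 n) ->
     uniq (map fst B ++ elabels (E1 ++ E2)) ->
     vk_eq (gauss ltn n (E1 ++ events L B ++ E2)) (gauss ltn n (E1 ++ events L B' ++ E2))) ->
  reduces B B'.
Proof.
move=> hu ha hv U V L; rewrite !map_cat uniq_catCA => u p.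
have pU : perm_eq (act L U) (iota 0 n) := perm_trans (perm_act _ _) p.
split; [by rewrite uniq_catCA; apply: hu | exact: ha |].
rewrite !events_cat (ha _ pU); apply: (hv) => //.
by rewrite elabels_cat !elabels_events.
Qed.

Lemma perm_split m L : m.+1 < n -> perm_eq L (iota 0 n) ->
  exists A a b C, [/\ L = A ++ a :: b :: C, size A = m, a != b, a < n & b < n].
Proof.
move=> mn p; have sL : size L = n by rewrite (perm_size p) size_iota.
have [|A [a [b [C [LE sA]]]]] := @swap_split _ m L; first by rewrite sL.
exists A, a, b, C; split=> //.
- have : uniq L by rewrite (perm_uniq p) iota_uniq.
  by rewrite LE cat_uniq => /and3P[_ _] /=; rewrite inE negb_or => /andP[/andP[]].
- by have := perm_mem p a; rewrite LE mem_cat mem_head orbT mem_iota => /esym.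
- by have := perm_mem p b; rewrite LE mem_cat !inE eqxx !orbT mem_iota => /esym.
Qed.

(** Since the passes are layered, every generator is an involution; with the next two lemmas the
    crossings obey the Coxeter relations of the symmetric group. *)
Lemma reduces_R2 x y m : m.+1 < n -> reduces [:: (x, m); (y, m)] [::].
Proof.
move=> mn; have E L : perm_eq L (iota 0 n) -> act L [:: (x, m); (y, m)] = L /\
  exists a b, [/\ a != b, a < n, b < n &
    events L [:: (x, m); (y, m)] = [:: (x, a, b); (y, b, a)]].
  move=> /(perm_split mn) [A [a [b [C [-> <- ab an bn]]]]].
  have -> : [:: (x, size A); (y, size A)] = shift (size A) [:: (x, 0); (y, 0)].
    by rewrite /shift /= addn0.
  by rewrite act_shift events_shift; split=> //; exists a, b.
apply: reduces_by => [s|L /E[]|L E1 E2 /E[_ [a [b [ab an bn ->]]]] /= u] //=.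
  by rewrite inE => /and3P[].
exact: gauss_R2.
Qed.

Lemma reduces_R3 x y z m : m.+2 < n ->
  reduces [:: (x, m); (y, m.+1); (z, m)] [:: (z, m.+1); (y, m); (x, m.+1)].
Proof.
move=> mn.
have E L : perm_eq L (iota 0 n) ->
  act L [:: (x, m); (y, m.+1); (z, m)] = act L [:: (z, m.+1); (y, m); (x, m.+1)] /\
  exists a b c, [/\ a != b, a != c & b != c] /\ [/\ a < n, b < n & c < n] /\
    events L [:: (x, m); (y, m.+1); (z, m)] = [:: (x, a, b); (y, a, c); (z, b, c)] /\
    events L [:: (z, m.+1); (y, m); (x, m.+1)] = [:: (z, b, c); (y, a, c); (x, a, b)].
  move=> p; have [A [a [b [C [LE sA ab an bn]]]]] := perm_split (ltnW mn) p.
  have : 0 < size C.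
    by have := perm_size p; rewrite LE size_iota size_cat sA /=; lia.
  case: C LE => // c C LE _.
  have cn : c < n.
    by have := perm_mem p c; rewrite LE mem_cat !inE eqxx !orbT mem_iota => /esym.
  have [ac bc] : a != c /\ b != c.
    have : uniq L by rewrite (perm_uniq p) iota_uniq.
    by rewrite LE cat_uniq => /and3P[_ _] /=; rewrite !inE !negb_or => /and3P[/and3P[_ -> _] /andP[]].
  have -> : [:: (x, m); (y, m.+1); (z, m)] = shift (size A) [:: (x, 0); (y, 1); (z, 0)].
    by rewrite /shift /= addn0 addn1 sA.
  have -> : [:: (z, m.+1); (y, m); (x, m.+1)] = shift (size A) [:: (z, 1); (y, 0); (x, 1)].
    by rewrite /shift /= addn0 addn1 sA.
  by rewrite LE !act_shift !events_shift; split=> //; exists a, b, c.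
apply: reduces_by => [s|L /E[]|L E1 E2 /E[_ [a [b [c [[ab ac bc] [[an bn cn] [-> ->]]]]]]] u] //.
  have pm : perm_eq ([:: x; y; z] ++ s) ([:: z; y; x] ++ s) by apply/permP => P /=; lia.
  by rewrite [uniq _](perm_uniq pm).
exact: gauss_R3.
Qed.

Lemma reduces_comm x y m p : m.+1 < n -> p.+1 < n -> m.+1 < p \/ p.+1 < m ->
  reduces [:: (x, m); (y, p)] [:: (y, p); (x, m)].
Proof.
(* Only [m.+1 < p] needs a computation; the other case is the same relation read backwards. *)
wlog suff main : x y m p / m.+1 < n -> p.+1 < n -> m.+1 < p ->
  (forall L, perm_eq L (iota 0 n) ->
   act L [:: (x, m); (y, p)] = act L [:: (y, p); (x, m)] /\
   exists a b c d, [/\ a != c, a != d, b != c & b != d] /\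
    events L [:: (x, m); (y, p)] = [:: (x, a, b); (y, c, d)] /\
    events L [:: (y, p); (x, m)] = [:: (y, c, d); (x, a, b)]).
  move=> mn pn mp.
  have un (s : seq nat) : uniq ([:: x; y] ++ s) -> uniq ([:: y; x] ++ s).
    by rewrite /= !inE !negb_or => /and3P[/andP[xy ->] -> ->]; rewrite eq_sym xy.
  case: mp => mp.
    have E := main x y m p mn pn mp.
    apply: reduces_by => [//|L /E[]|L E1 E2 /E[_ [a [b [c [d [[ac ad bc bd] [-> ->]]]]]]] _] //.
    by rewrite gauss_comm //; apply: vk_refl.
  have E := main y x p m pn mn mp.
  apply: reduces_by => [//|L /E[]|L E1 E2 /E[_ [a [b [c [d [[ac ad bc bd] [-> ->]]]]]]] _] //.
  by rewrite -gauss_comm //; apply: vk_refl.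
move=> mn pn mp L pL; have [A [a [b [C [LE sA _ _ _]]]]] := perm_split mn pL.
have [|C' [c [d [D [CE sC]]]]] := @swap_split _ (p - m.+2) C.
  by have := perm_size pL; rewrite LE size_iota size_cat sA /=; lia.
have uL : uniq L by rewrite (perm_uniq pL) iota_uniq.
have pE : p = size A + (size C' + 0).+2 by lia.
have -> : [:: (x, m); (y, p)] = shift (size A) [:: (x, 0); (y, (size C' + 0).+2)].
  by rewrite /shift /= -pE addn0 sA.
have -> : [:: (y, p); (x, m)] = shift (size A) [:: (y, (size C' + 0).+2); (x, 0)].
  by rewrite /shift /= -pE addn0 sA.
rewrite LE !act_shift !events_shift /= CE swap_cat /=; split=> //.
have nC k : nth 0 (C' ++ [:: c, d & D]) (size C' + k) = nth 0 [:: c, d & D] k.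
  by rewrite nth_cat ltnNge leq_addr addKn.
exists a, b, c, d; split; last by rewrite -addnS !nC.
move: uL; rewrite LE CE cat_uniq => /and3P[_ _] /=; rewrite !inE !mem_cat !inE !negb_or.
by case/and3P=> /and5P[_ _ -> -> _] /and4P[_ -> -> _] _.
Qed.

Lemma reduces_catl A B B' : reduces B B' -> reduces (A ++ B) (A ++ B').
Proof. by move=> h; have := @reduces_context A _ _ [::] h; rewrite !cats0. Qed.

Lemma reduces_catr A B B' : reduces B B' -> reduces (B ++ A) (B' ++ A).
Proof. exact: (@reduces_context [::] B B' A). Qed.

Lemma reduces_comm_list D y m : m.+1 < n ->
  (forall c, c \in D -> c.2.+1 < n /\ (c.2.+1 < m \/ m.+1 < c.2)) ->
  reduces (D ++ [:: (y, m)]) ((y, m) :: D).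
Proof.
move=> mn; elim: D => [|[x p] D IH] h; first exact: reduces_refl.
apply: (@reduces_trans ([:: (x, p); (y, m)] ++ D)).
  by apply: (@reduces_catl [:: (x, p)]); apply: IH => c cD; apply: h; rewrite inE cD orbT.
apply: (@reduces_catr D [:: (x, p); (y, m)] [:: (y, m); (x, p)]).
by have [h1 h2] := h (x, p) (mem_head _ _); apply: reduces_comm.
Qed.

(* [D] represents a right coset of the subgroup generated by the transpositions beyond [p]. *)
Lemma reduces_normal p B :
  (forall c, c \in B -> p <= c.2 /\ c.2.+1 < n) -> p < n ->
  exists B' D a, [/\ reduces B (B' ++ D), forall c, c \in B' -> p.+1 <= c.2 /\ c.2.+1 < n,
    map snd D = iota p a & p + a < n].
Proof.
elim/last_ind: B => [|B [y m] IH] hB pn.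
  by exists [::], [::], 0; rewrite addn0; split=> //; apply: reduces_refl.
have [||B' [D [a [h hB' hD pa]]]] := IH => //.
  by move=> c cB; apply: hB; rewrite mem_rcons inE cB orbT.
have /= [pm mn] : p <= (y, m).2 /\ (y, m).2.+1 < n.
  by apply: hB; rewrite mem_rcons mem_head.
have {}h : reduces (rcons B (y, m)) (B' ++ (D ++ [:: (y, m)])).
  by rewrite -cats1 catA; apply: reduces_catr.
have Dm c : c \in D -> p <= c.2 < p + a.
  by move=> cD; have : c.2 \in map snd D := map_f _ cD; rewrite hD mem_iota.
have sD : size D = a by rewrite -(size_map snd) hD size_iota.
case: (ltngtP m (p + a)) => mpa.
- case: (ltngtP m.+1 (p + a)) => mpa'; first last.
  (* Here [m] is the last position of [D], and the two crossings cancel. *)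
  + case/lastP: D hD sD h Dm => [|D [x q]] hD sD h Dm; first by move: sD => /=; lia.
    move: sD hD; rewrite size_rcons map_rcons => sD.
    rewrite -sD -addn1 iotaD cats1 => /rcons_inj [hD qE].
    exists B', D, (size D); split=> //; last by lia.
    apply: reduces_trans h _; apply: reduces_catl.
    rewrite -cats1 -catA; have -> : q = m by lia.
    rewrite -[X in reduces _ X]cats0; apply: reduces_catl.
    by apply: reduces_R2.
  + lia.
  (* Both [m] and [m.+1] occur in [D]. The new crossing commutes with the part beyond [m.+1], turns
     into one at [m.+1] by the braid relation, and then commutes with the part before [m] to reach
     [B']. *)
  have DE : map snd D = iota p (m - p) ++ [:: m; m.+1] ++ iota m.+2 (p + a - m.+2).
    have aE : a = (m - p) + (p + a - m.+2).+2 by lia.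
    by rewrite hD [in LHS]aE iotaD subnKC.
  have [D1 [D' [DD D1E D'E]]] := map_eq_cat DE; rewrite {}DD in h.
  case: D' D'E h => // -[x1 m1] [//|[x2 m2] D2] /= [-> -> D2E] h.
  exists (rcons B' (y, m.+1)), (D1 ++ [:: (x2, m); (x1, m.+1)] ++ D2), a; split=> //.
  + apply: reduces_trans h _; rewrite cat_rcons; apply: reduces_catl.
    apply: (@reduces_trans (D1 ++ [:: (x1, m); (x2, m.+1); (y, m)] ++ D2)).
      rewrite -catA; apply: reduces_catl.
      apply: (@reduces_catl [:: (x1, m); (x2, m.+1)] (D2 ++ [:: (y, m)]) ((y, m) :: D2)).
      apply: reduces_comm_list => // c cD.
      by have : c.2 \in map snd D2 := map_f snd cD; rewrite D2E mem_iota; case: c {cD} => ? ? /=; lia.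
    apply: (@reduces_trans (D1 ++ [:: (y, m.+1); (x2, m); (x1, m.+1)] ++ D2)).
      by apply/reduces_catl/reduces_catr/reduces_R3; lia.
    rewrite -[X in reduces X _]/(D1 ++ [:: (y, m.+1)] ++ [:: (x2, m); (x1, m.+1)] ++ D2) catA.
    apply: (@reduces_catr _ (D1 ++ [:: (y, m.+1)]) ((y, m.+1) :: D1)).
    apply: reduces_comm_list => [|c cD]; first by lia.
    by have : c.2 \in map snd D1 := map_f snd cD; rewrite D1E mem_iota; case: c {cD} => ? ? /=; lia.
  + by move=> c; rewrite mem_rcons inE => /orP[/eqP -> /=|/hB' //]; lia.
  + by rewrite -hD DE !map_cat D1E D2E.
(* Beyond the end of [D] the crossing commutes with all of [D]. *)
- exists (rcons B' (y, m)), D, a; split=> //.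
    apply: reduces_trans h _; rewrite cat_rcons; apply: reduces_catl.
    by apply: reduces_comm_list => // -[? ?] /Dm /=; lia.
  by move=> c; rewrite mem_rcons inE => /orP[/eqP -> /=|/hB' //]; lia.
(* Here [m] prolongs the run [D]. *)
- exists B', (D ++ [:: (y, m)]), a.+1; split=> //; last by lia.
  by rewrite map_cat hD -[a.+1]addn1 iotaD mpa.
Qed.

(** A nonempty run displaces the entry at its first position, which rules it out in a word that acts
    trivially. *)
Lemma act_pass (T : Type) (A C : seq T) (a : T) D k :
  map snd D = iota (size A) k -> k <= size C ->
  act (A ++ a :: C) D = A ++ take k C ++ a :: drop k C.
Proof.
elim: D A C k => [|[x m] D IH] A C [|k] //=; first by rewrite take0 drop0.
case=> -> hD; case: C => // b C kC.
rewrite -[size A]addn0 swap_cat /= -cat_rcons (IH _ _ k) ?size_rcons //.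
by rewrite cat_rcons.
Qed.

Lemma act_nth_below p L B : (forall c, c \in B -> p.+1 <= c.2) ->
  nth 0 (act L B) p = nth 0 L p.
Proof.
elim: B L => //= c B IH L h; rewrite IH => [|d dB]; last by apply: h; rewrite inE dB orbT.
move: (h c (mem_head _ _)); move: c.2 => {h} m.
by elim: m p L {IH} => // m IHm [|p] [|a L] //=; apply: IHm.
Qed.

(** Fixing one arrangement of distinct passes means representing the identity. In the normal form
    [B' ++ D] the factor [B'] leaves position [p] alone, so the run [D] must be empty, and the
    induction continues beyond [p]. *)
Lemma reduces_nil p B : (forall c, c \in B -> p <= c.2 /\ c.2.+1 < n) ->
  uniq (map fst B) -> (exists2 L, perm_eq L (iota 0 n) & act L B = L) -> reduces B [::].
Proof.
have [d] := ubnP (n - p); elim: d => // d IH in p B * => dn hB uB hL.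
case: (ltnP p n) => pn; last first.
  by case: B hB {hL uB} => [|c B] hB;
    [exact: reduces_refl|have := hB c (mem_head _ _); lia].
have [B' [D [a [h hB' hD pa]]]] := reduces_normal hB pn.
have [L pL LB] := hL.
have [] := h [::] [::] L; rewrite ?cats0 //= => uD actE _.
pose L1 := act L B'.
have pL1 : perm_eq L1 (iota 0 n) := perm_trans (perm_act _ _) pL.
have sL1 : size L1 = n by rewrite (perm_size pL1) size_iota.
have nL1 : nth 0 L1 p = nth 0 L p by apply: act_nth_below => c /hB' [].
have L1E : L1 = take p L1 ++ nth 0 L1 p :: drop p.+1 L1.
  by rewrite -drop_nth ?cat_take_drop ?sL1.
have sA : size (take p L1) = p by rewrite size_takel // sL1 ltnW.
have a0 : a = 0.
  case: a {h} hD pa => // a hD pa; move: LB; rewrite actE act_cat -/L1 L1E.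
  rewrite (@act_pass _ _ _ _ _ a.+1) ?sA //; last by rewrite size_drop sL1; lia.
  move=> /(congr1 (nth 0 ^~ p)); rewrite -nL1 nth_cat sA ltnn subnn.
  have : uniq L1 by rewrite (perm_uniq pL1) iota_uniq.
  rewrite [in uniq _]L1E cat_uniq => /and3P[_ _].
  have : 0 < size (drop p.+1 L1) by rewrite size_drop sL1; lia.
  case: (drop p.+1 L1) => //= b C _.
  by move=> /andP[/negP bC _] E; case: bC; rewrite -E mem_head.
move: hD; rewrite {}a0 => /(congr1 size)/eqP; rewrite size_map size_iota => /nilP D0.
rewrite {}D0 cats0 in h actE uD.
apply: reduces_trans h _; apply: (IH p.+1) => //; first by lia.
by exists L => //; rewrite -actE.
Qed.

(* The passes are numbered starting with the virtual overstrand, so pass 0 leaves the virtual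
   block at the bottom and the last pass ends at the top.  [M] lists the passes that end at the
   other positions; the virtual block moves these up by one and their successors start there. *)
Definition closes (M : seq nat) (B : seq crossing) : Prop :=
  act (rcons (map S M) 0) B = n.-1 :: M.

Definition unknots (M : seq nat) : Prop := forall B,
  uniq (map fst B) -> (forall c, c \in B -> c.2.+1 < n) -> closes M B ->
  vk_eq (gauss ltn n (events (rcons (map S M) 0) B)) [::].

Lemma fresh_labels (s : seq nat) : exists x y, x != y /\ uniq s = uniq [:: x, y & s].
Proof.
have f k : \max_(i <- s) i + k.+1 \notin s.
  apply/negP => h; suff : \max_(i <- s) i + k.+1 <= \max_(i <- s) i by lia.
  exact: (@leq_bigmax_seq _ _ xpredT id _ h isT).
exists (\max_(i <- s) i + 1), (\max_(i <- s) i + 2).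
by rewrite /= inE negb_or !f andbT; split; lia.
Qed.

(* Inserting a cancelling pair of crossings and sliding one of them around the closure
   exchanges two passes that end at adjacent positions. *)
Lemma unknots_swap A a b C : perm_eq (A ++ a :: b :: C) (iota 0 n.-1) ->
  unknots (A ++ b :: a :: C) -> unknots (A ++ a :: b :: C).
Proof.
set M := A ++ _; set M' := A ++ b :: _ => pM h B uB hB cB.
have bound c : c \in M -> c.+1 < n.
  by rewrite (perm_mem pM) mem_iota; lia.
have an : a.+1 < n by apply: bound; rewrite mem_cat mem_head orbT.
have bn : b.+1 < n by apply: bound; rewrite mem_cat !inE eqxx !orbT.
have ab : a != b.
  have : uniq M by rewrite (perm_uniq pM) iota_uniq.
  by rewrite cat_uniq => /and3P[_ _] /=; rewrite inE negb_or => /andP[/andP[]].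
have mn : (size A).+2 < n.
  by have := perm_size pM; rewrite size_cat size_iota /=; lia.
have [x [y [xy uxy]]] := fresh_labels (map fst B); rewrite uB in uxy.
have swapM : swap (size A) (rcons (map S M') 0) = rcons (map S M) 0.
  rewrite /M /M' !map_cat !rcons_cat -{1}(size_map S A) -[size (map S A)]addn0.
  by rewrite swap_cat.
have nthM : nth 0 (rcons (map S M') 0) (size A) = b.+1 /\
            nth 0 (rcons (map S M') 0) (size A).+1 = a.+1.
  rewrite /M' map_cat rcons_cat !nth_cat size_map ltnn subnn.
  by rewrite ltnNge leqnSn /= subSnn.
have nthM' : nth 0 (n.-1 :: M) (size A).+1 = a /\ nth 0 (n.-1 :: M) (size A).+2 = b.
  by rewrite /= !nth_cat ltnn subnn ltnNge leqnSn /= subSnn.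
(* The crossing [x] turns the start for [M'] into the start for [M], and [y] turns the final [M]
   into [M']. Its position is one larger because [n.-1] precedes [M] in the final arrangement. *)
have := h ((x, size A) :: B ++ [:: (y, (size A).+1)]).
rewrite /closes /= swapM act_cat cB /= events_cat cB /= nthM.1 nthM.2.
rewrite -[nth 0 M (size A)]/(nth 0 (n.-1 :: M) (size A).+1).
rewrite -[nth 0 M (size A).+1]/(nth 0 (n.-1 :: M) (size A).+2) nthM'.1 nthM'.2.
set E := events _ B => hE; have {}hE : vk_eq (gauss ltn n
    (((x, b.+1, a.+1) :: E) ++ [:: (y, a, b)])) [::].
  apply: hE.
  - rewrite map_cat /= cats1 mem_rcons rcons_uniq.
    by move: uxy; rewrite /= inE negb_or => /esym/and3P[-> -> ->].
  - move=> c; rewrite inE mem_cat !inE => /or3P[/eqP -> /=|/hB //|/eqP -> //].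
    exact: ltnW mn.
  - by rewrite -[size A]addn0 swap_cat.
(* Slid around the closure, [y] stands next to [x] and cancels it. *)
apply: vk_trans hE; apply: vk_sym; rewrite gauss_conj //.
apply: (@gauss_R2 n [::] E y x a.+1 b.+1) => //.
rewrite /E /= elabels_events; move: uxy; rewrite /= !inE !negb_or => /esym/and3P[].
by case/andP=> _ -> -> ->; rewrite eq_sym xy.
Qed.

(** A selection sort: [D] is already in place, and the next entry is brought forward through [M1] by
    adjacent exchanges. *)
Lemma unknots_perm D M M' : perm_eq (D ++ M) (iota 0 n.-1) -> perm_eq M M' ->
  unknots (D ++ M') -> unknots (D ++ M).
Proof.
elim: M D M' => [|a M IH] D M' pD pM h.
  by move: pM; rewrite perm_sym => /perm_nilP E; rewrite E in h.
have aM : a \in M' by rewrite -(perm_mem pM) mem_head.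
case/splitPr: aM pM h => M1 M2 pM h.
have pM12 : perm_eq M (M1 ++ M2).
  by rewrite -(perm_cons a); apply: perm_trans pM _; rewrite perm_catC /= perm_cons perm_catC.
have p12 : perm_eq (D ++ a :: M1 ++ M2) (iota 0 n.-1).
  by apply: perm_trans pD; rewrite perm_cat2l perm_cons perm_sym.
have {}h : unknots (D ++ a :: M1 ++ M2).
  elim/last_ind: M1 M2 h p12 {pM pM12} => // M1 b IHM M2; rewrite cat_rcons => h p12.
  rewrite cat_rcons; apply: IHM; last by rewrite cat_rcons in p12.
  rewrite catA; apply: unknots_swap; last by rewrite -catA.
  apply: perm_trans p12; rewrite -catA perm_cat2l cat_rcons.
  by apply/permP => P; rewrite /= !count_cat /=; lia.
by have := IH (rcons D a) (M1 ++ M2); rewrite !cat_rcons; exact.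
Qed.

(** For the decreasing order the passes start and end in the same arrangement, so [reduces_nil]
    applies. *)
Lemma unknots_all M : 0 < n -> perm_eq M (iota 0 n.-1) -> unknots M.
Proof.
move=> n0 pM.
apply: (@unknots_perm [::] M (rev (iota 0 n.-1)) pM).
  by rewrite perm_sym perm_rev perm_sym.
move=> B uB hB cB; rewrite /= /closes in cB *.
have LE : rcons (map S (rev (iota 0 n.-1))) 0 = n.-1 :: rev (iota 0 n.-1).
  rewrite map_rev -rev_cons -(iotaDl 1) -[0 :: _]/(iota 0 1 ++ iota 1 n.-1).
  by rewrite -iotaD -(addnC n.-1) iotaD rev_cat.
rewrite LE in cB *.
have pL : perm_eq (n.-1 :: rev (iota 0 n.-1)) (iota 0 n).
  rewrite -[in iota 0 n](prednK n0) -addn1 iotaD perm_sym perm_catC /= perm_cons.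
  by rewrite perm_sym perm_rev.
have hn : reduces B [::].
  apply: (@reduces_nil 0) => //; first by move=> c /hB.
  by exists (n.-1 :: rev (iota 0 n.-1)).
have [|//|_ _] := hn [::] [::] (n.-1 :: rev (iota 0 n.-1)); first by rewrite /= cats0.
rewrite /= !cats0 => h; apply: vk_trans h _.
suff -> : gauss ltn n [::] = [::] by apply: vk_refl.
by rewrite /gauss /strands; elim: (iota _ _).
Qed.
End Reduction.

(** * Indices and crossing changes in closed braids *)

Definition valid_event (n : nat) (e : event) : bool :=
  [&& e.1.2 < n, e.2 < n & e.1.2 != e.2].

Lemma nth_adjacent (A C : seq nat) a b :
  nth 0 (A ++ a :: b :: C) (size A) = a /\ nth 0 (A ++ a :: b :: C) (size A).+1 = b.
Proof. by rewrite !nth_cat ltnn subnn ltnNge leqnSn subSnn. Qed.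

Lemma valid_events n L B : perm_eq L (iota 0 n) -> (forall c, c \in B -> c.2.+1 < n) ->
  all (valid_event n) (events L B).
Proof.
elim: B L => //= c B IH L pL hB; apply/andP; split; last first.
  by apply: IH => [|d dB]; [exact: perm_trans (perm_swap _ _) pL | apply: hB; rewrite inE dB orbT].
have [A [a [b [C [-> sA ab an bn]]]]] := perm_split (hB c (mem_head _ _)) pL.
by have [na nb] := nth_adjacent A C a b; rewrite /valid_event /= -sA na nb an bn.
Qed.

Lemma event_strands ov (e : event) : e.1.2 != e.2 ->
  [/\ strand ov e.1.2 [:: e] = [:: upper_letter ov e],
      strand ov e.2 [:: e] = [:: lower_letter ov e] &
      forall r, r != e.1.2 -> r != e.2 -> strand ov r [:: e] = [::]].
Proof.
move=> ab; rewrite /strand /event_letters /= !eqxx eq_sym (negbTE ab).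
by split=> // r /negbTE -> /negbTE ->.
Qed.

(** Turns sums over the letters of the code into sums over the crossings of the braid. *)
Lemma perm_gauss ov n E : all (valid_event n) E ->
  perm_eq (gauss ov n E) (flatten [seq [:: upper_letter ov e; lower_letter ov e] | e <- E]).
Proof.
elim: E => [|e E IH] /=.
  by rewrite /gauss /strands; elim: (iota _ _).
move=> /andP[/and3P[an bn ab] /IH pE].
have [sa sb other] := event_strands ov ab.
rewrite -[_ :: _ :: _]/([:: upper_letter ov e; lower_letter ov e] ++ _).
rewrite -(perm_cat2l [:: upper_letter ov e; lower_letter ov e]) in pE.
apply: perm_trans pE; apply/permP => P.
case: (ltngtP e.1.2 e.2) => lt; last by rewrite lt eqxx in ab.
- rewrite (@gauss_split2 ov n e.1.2 e.2 [::] [:: e] E) ?lt // sa sb.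
  rewrite (@gauss_split2 ov n e.1.2 e.2 [::] [::] E) ?lt //.
  by rewrite !count_cat /=; lia.
- have other' r : r != e.2 -> r != e.1.2 -> strand ov r [:: e] = [::] by auto.
  rewrite (@gauss_split2 ov n e.2 e.1.2 [::] [:: e] E) ?lt // sa sb.
  rewrite (@gauss_split2 ov n e.2 e.1.2 [::] [::] E) ?lt //.
  by rewrite !count_cat /=; lia.
Qed.

Lemma gauss_well_paired ov n E : all (valid_event n) E -> uniq (elabels E) ->
  well_paired (gauss ov n E).
Proof.
move=> vE uE; have /permPl pE := perm_gauss ov vE.
apply: (well_paired_perm (w := flatten [seq [:: upper_letter ov e; lower_letter ov e] | e <- E])).
  by rewrite perm_sym pE.
elim: E uE {vE pE} => [|e E IH] /=; first by move=> _ c; rewrite big_nil eqxx.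
move=> /andP[eE uE].
rewrite -[_ :: _ :: _]/([:: upper_letter ov e; lower_letter ov e] ++ _).
apply: (well_paired_perm (w := _ ++ [:: upper_letter ov e; lower_letter ov e])).
  by rewrite perm_catC.
have wp : well_paired [:: upper_letter ov e; lower_letter ov e] by apply: well_paired_pair.
apply: (proj1 (well_paired_cat _ wp) (IH uE)) => c.
rewrite !inE /lab /= orbb => /eqP ->; apply: contra eE.
by elim: E {IH uE} => //= d E IH; rewrite !inE orbA orbb => /orP[->|/IH ->]; rewrite ?orbT.
Qed.

Lemma mem_events L B e : e \in events L B -> exists B1 c B2,
  B = B1 ++ c :: B2 /\ e = (c.1, nth 0 (act L B1) c.2, nth 0 (act L B1) c.2.+1).
Proof.
elim: B L => //= c B IH L; rewrite inE => /orP[/eqP ->|/IH [B1 [d [B2 [-> ->]]]]].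
  by exists [::], c, B.
by exists (c :: B1), d, B2.
Qed.

(** * Indices of the crossings of a closed braid *)

Section Index.
Local Open Scope ring_scope.

Lemma height_strand_cons ov r e E :
  height (strand ov r (e :: E)) = height (event_letters ov r e) + height (strand ov r E).
Proof. by rewrite -height_cat. Qed.

Lemma height_event ov r e : e.1.2 != e.2 ->
  height (event_letters ov r e) = (r == e.1.2)%:Z - (r == e.2)%:Z.
Proof.
move=> ab; rewrite /event_letters /height; case: (r =P e.1.2) => [->|_].
  by rewrite (negbTE ab) big_seq1 /dir /= eqxx.
by case: (r =P e.2) => _; rewrite ?big_nil // big_seq1 /dir /=; case: (ov _ _).
Qed.

Lemma index_swap (L : seq nat) m r : uniq L -> (m.+1 < size L)%N ->
  (index r (swap m L))%:Z =
  (index r L)%:Z + ((r == nth 0%N L m)%:Z - (r == nth 0%N L m.+1)%:Z).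
Proof.
move=> uL /swap_split [A [a [b [C [LE <-]]]]]; move: uL; rewrite {}LE cat_uniq.
move=> /and3P[_ /hasPn hA /= /andP[ab _]].
have [-> ->] := nth_adjacent A C a b.
rewrite -[size A]addn0 swap_cat /= !index_cat.
have aA := hA a (mem_head _ _); have bA : b \notin A by apply: hA; rewrite !inE eqxx orbT.
have {ab hA} /negbTE ab : a != b by apply: contraNneq ab => ->; apply: mem_head.
have [rA|rA] := boolP (r \in A).
  have [-> ->] : r == a = false /\ r == b = false.
    by split; apply: contraTF rA => /eqP ->.
  lia.
rewrite /= ![_ == r]eq_sym; case: (r =P a) => [->|ra]; first by rewrite ab; lia.
by case: (r =P b) => rb; lia.
Qed.

Lemma displacement ov L B r : uniq L -> (forall c, c \in B -> (c.2.+1 < size L)%N) ->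
  (index r (act L B))%:Z = (index r L)%:Z + height (strand ov r (events L B)).
Proof.
elim: B L => [|c B IH] L uL hB /=.
  by rewrite /strand /height big_nil addr0.
have cL := hB c (mem_head _ _).
rewrite IH ?(perm_uniq (perm_swap _ _)) //; last first.
  by move=> d dB; rewrite size_swap; apply: hB; rewrite inE dB orbT.
rewrite index_swap // height_strand_cons height_event ?addrA //=.
by rewrite nth_uniq ?(ltnW cL) // neq_ltn ltnSn.
Qed.

Lemma chord_index_two c u1 l u2 l' u3 : lab l = c -> lab l' = c ->
  c \notin labels (u1 ++ u2 ++ u3) ->
  chord_index c false (u1 ++ [:: l] ++ u2 ++ [:: l'] ++ u3) = height u2.
Proof.
rewrite !labels_cat !mem_cat !negb_or => lc lc' /and3P[c1 c2 c3].
rewrite !chord_index_cat /= lc lc' eqxx (count_memPn c1) (count_memPn c2) /=.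
rewrite (chord_index_notin _ c1) (chord_index_notin _ c2) (chord_index_notin _ c3) /=.
by rewrite !add0r addr0.
Qed.

Lemma height_strands ov p q E :
  height (strands ov p q E) = \sum_(p <= r < q) height (strand ov r E).
Proof.
rewrite /strands /index_iota; elim: (iota _ _) => [|r s IH] /=.
  by rewrite /height !big_nil.
by rewrite height_cat IH big_cons.
Qed.

Section Closed.
Variables (n : nat) (M : seq nat) (B : seq crossing) (ov : rel nat).
Hypotheses (n0 : (0 < n)%N) (pM : perm_eq M (iota 0 n.-1)) (uB : uniq (map fst B)).
Hypotheses (hB : forall c, c \in B -> (c.2.+1 < n)%N) (cB : closes n M B).
Let L0 := rcons (map S M) 0%N.

Lemma perm_start : perm_eq L0 (iota 0 n).
Proof.
rewrite /L0 perm_rcons -(prednK n0) /= perm_cons -[1%N]addn0 iotaDl.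
exact: perm_map.
Qed.

(** The summand 1 is the step up inside the virtual block, between the end of pass [r] and the start
    of the classical part of pass [r.+1]. *)
Lemma closing_index r : (r.+1 < n)%N ->
  (index r (act L0 B))%:Z = (index r.+1 L0)%:Z + 1.
Proof.
move=> rn; rewrite cB /L0 /= gtn_eqF; last by lia.
rewrite -cats1 index_cat mem_map ?index_map; [|exact: succn_inj..].
by rewrite (perm_mem pM) mem_iota /= ifT; lia.
Qed.

(* Each classical crossing moves its upper strand one position down and its lower strand one
   position up, so the heights along the path between the two visits of a crossing add up to
   the displacement, except that the virtual block moves every pass it carries over one up. *)
Lemma event_index e : e \in events L0 B ->
  chord_index e.1.1 false (gauss ov n (events L0 B)) != 0.
Proof.
move=> /mem_events [B1 [c [B2 [BE ->]]]] /=; set L1 := act L0 B1; set L2 := swap c.2 L1.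
have cn : (c.2.+1 < n)%N by apply: hB; rewrite BE mem_cat mem_head orbT.
have pL1 : perm_eq L1 (iota 0 n) := perm_trans (perm_act _ _) perm_start.
have pL2 : perm_eq L2 (iota 0 n) := perm_trans (perm_swap _ _) pL1.
have sizeL L : perm_eq L (iota 0 n) -> size L = n by move/perm_size; rewrite size_iota.
have uniqL L : perm_eq L (iota 0 n) -> uniq L by move/perm_uniq; rewrite iota_uniq.
have LfE : act L2 B2 = act L0 B by rewrite BE act_cat.
set E1 := events L0 B1; set E2 := events L2 B2.
have [A [a [b [C [L1E sA ab an bn]]]]] := perm_split cn pL1.
have [na nb] := nth_adjacent A C a b; rewrite sA -L1E in na nb.
have EE : events L0 B = E1 ++ [:: (c.1, a, b)] ++ E2.
  by rewrite BE events_cat /= -/L1 na nb.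
have /= [sa sb other] := @event_strands ov (c.1, a, b) ab.
have [ia ib] : index a L2 = index b L1 /\ index b L2 = index a L1.
  have [uA [aA bA]] : uniq L1 /\ a \notin A /\ b \notin A.
    have uL := uniqL L1 pL1; split=> //; move: uL; rewrite L1E cat_uniq.
    by move=> /and3P[_ /hasPn hA _]; rewrite !hA // !inE eqxx ?orbT.
  rewrite /L2 L1E -sA -[size A]addn0 swap_cat !index_cat (negbTE aA) (negbTE bA) /= !eqxx.
  by rewrite [b == a]eq_sym (negbTE ab).
(* [lo] is the pass that visits the crossing first; after it, [lo] stands where [hi] stood before
   it. *)
have main lo hi : (lo < hi < n)%N -> index lo L2 = index hi L1 ->
    (forall r, r != lo -> r != hi -> strand ov r [:: (c.1, a, b)] = [::]) ->
    height (strand ov lo E2 ++ strands ov lo.+1 hi (E1 ++ E2) ++ strand ov hi E1) != 0.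
  move=> lohi il oth; rewrite !height_cat height_strands.
  have hd1 : (index hi L1)%:Z = (index hi L0)%:Z + height (strand ov hi E1).
    apply: displacement; first exact: uniqL perm_start.
    by move=> d dB; rewrite (sizeL _ perm_start); apply: hB; rewrite BE mem_cat dB.
  have hd2 : (index lo (act L0 B))%:Z = (index lo L2)%:Z + height (strand ov lo E2).
    rewrite -LfE; apply: displacement; first exact: uniqL.
    by move=> d dB; rewrite (sizeL L2) //; apply: hB; rewrite BE mem_cat inE dB !orbT.
  have hd r : (lo < r < hi)%N ->
      height (strand ov r (E1 ++ E2)) =
      ((index r.+1 L0 + r.+1)%:Z - (index r L0 + r)%:Z).
    move=> rb; have := @displacement ov L0 B r (uniqL _ perm_start).
    rewrite EE strand_mid; last by apply: oth; lia.
    rewrite (closing_index (r := r)); last by lia.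
    move=> dE.
    have : (index r.+1 L0)%:Z + 1 = (index r L0)%:Z + height (strand ov r (E1 ++ E2)).
      by apply: dE => d dB; rewrite (sizeL _ perm_start); apply: hB.
    lia.
  (* After telescoping, all positions cancel and [hi - lo] remains. *)
  rewrite (eq_big_nat _ _ hd) telescope_sumr; last by lia.
  have := closing_index (r := lo); lia.
have fresh p q : c.1 \notin labels ((strands ov 0 p (E1 ++ E2) ++ strand ov p E1) ++
   (strand ov p E2 ++ strands ov p.+1 q (E1 ++ E2) ++ strand ov q E1) ++
   (strand ov q E2 ++ strands ov q.+1 n (E1 ++ E2))).
  have : c.1 \notin elabels (E1 ++ E2).
    move: uB; rewrite BE -(elabels_events L0) -BE EE !elabels_cat /= cat_uniq mem_cat negb_or.
    by move=> /and3P[_ /= /norP[-> _] /andP[-> _]].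
  exact: fresh_around2.
rewrite EE; case: (ltngtP a b) ab => // lt _.
- rewrite (@gauss_split2 ov n a b) ?lt // sa sb chord_index_two //.
  by apply: main; rewrite ?lt.
- have other' r : r != b -> r != a -> strand ov r [:: (c.1, a, b)] = [::].
    by move=> rb ra; apply: other.
  rewrite (@gauss_split2 ov n b a) ?lt // sa sb chord_index_two //.
  by apply: main; rewrite ?lt.
Qed.
End Closed.
End Index.

(** * Counting the crossing changes *)

Definition positive : rel nat := fun _ _ => true.

(** By [event_index] every crossing has nonzero index whatever [ov] is, so the invariant is twice
    the ordinary writhe. *)
Lemma gauss_index_writhe ov n M B : 0 < n -> perm_eq M (iota 0 n.-1) ->
  uniq (map fst B) -> (forall c, c \in B -> c.2.+1 < n) -> closes n M B ->
  let E := events (rcons (map S M) 0) B in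
  index_writhe (gauss ov n E) =
  (((size E)%:Z - (2 * count (fun e => ~~ ov e.1.2 e.2) E)%N%:Z) *+ 2)%R.
Proof.
move=> n0 pM uB hB cB E.
have vE : all (valid_event n) E := valid_events (perm_start n0 pM) hB.
rewrite (@index_writhe_eq _ xpred0); last first.
  move=> c /mapP [l lE ->]; apply/negbTE.
  move: lE; rewrite (perm_mem (perm_gauss ov vE)) => /flatten_mapP [e eE].
  rewrite !inE /lab => /orP[] /eqP -> /=; exact: event_index.
rewrite (perm_big _ (perm_gauss ov vE)) /= big_flatten big_map.
elim: E {vE} => [|e E IH]; first by rewrite big_nil.
by rewrite big_cons {}IH !big_cons big_nil /=; case: (ov _ _); rewrite /sgn /=; lia.
Qed.

Definition cc_word (w : word) (cs : seq nat) : word :=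
  foldl (fun w c => map (cc_letter c) w) w cs.

Lemma reach_cc_word w cs : {subset cs <= labels w} -> vk_eq (cc_word w cs) [::] ->
  reach (size cs) w [::].
Proof.
elim: cs w => [|c cs IH] w sub h /=; first exact: reach_eq.
apply: (reach_cc (vk_refl w)); first by apply: sub; apply: mem_head.
by apply: IH => // d dc; rewrite cc_labels; apply: sub; rewrite inE dc orbT.
Qed.

Lemma cc_wordE w cs : uniq cs ->
  cc_word w cs = [seq if lab l \in cs then (l.1.1, ~~ l.1.2, ~~ l.2) else l | l <- w].
Proof.
elim: cs w => [|c cs IH] w /=; first by rewrite map_id.
move=> /andP[ccs ucs]; rewrite IH // -map_comp; apply: eq_map => l /=.
rewrite cc_lab inE /cc_letter; case: (lab l =P c) => [E|//].
by rewrite E (negbTE ccs).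
Qed.

Lemma uniq_map_inj (T U : eqType) (f : T -> U) s :
  uniq (map f s) -> {in s &, injective f}.
Proof.
elim: s => //= a s IH /andP[ha us] x y; rewrite !inE.
case/orP=> [/eqP->|xs] /orP[/eqP->|ys] // e; last exact: IH.
  by rewrite e map_f in ha.
by rewrite -e map_f in ha.
Qed.

(** At a positive crossing the pass moving down is over; a change is called for exactly when this
    pass is not the earlier one. *)
Lemma gauss_layered n E : uniq (elabels E) ->
  gauss ltn n E =
  cc_word (gauss positive n E) [seq e.1.1 | e <- E & ~~ (e.1.2 < e.2)].
Proof.
move=> uE; rewrite cc_wordE; last first.
  by rewrite (subseq_uniq _ uE) // map_subseq ?filter_subseq.
set cs := [seq e.1.1 | e <- _]; rewrite /gauss /strands map_flatten -map_comp; congr flatten.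
apply: eq_map => r /=; rewrite /strand map_flatten -map_comp; congr flatten.
apply/eq_in_map => e eE /=.
have ecs : (e.1.1 \in cs) = ~~ (e.1.2 < e.2).
  apply/mapP/idP => [[d]|he]; last by exists e; rewrite ?mem_filter ?he.
  rewrite mem_filter => /andP[hd dE] ed.
  by have -> : e = d by apply: (uniq_map_inj uE).
by rewrite /event_letters; case: ifP => _; [|case: ifP => _];
  rewrite //= /upper_letter /lower_letter /lab /= ecs; case: (_ < _).
Qed.

Lemma closed_braid_vu n M B : 0 < n -> perm_eq M (iota 0 n.-1) ->
  uniq (map fst B) -> (forall c, c \in B -> c.2.+1 < n) -> closes n M B ->
  exists u, is_vu (gauss positive n (events (rcons (map S M) 0) B)) u /\ 2 * u = size B.
Proof.
move=> n0 pM uB hB cB; set E := events _ B.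
have vE : all (valid_event n) E := valid_events (perm_start n0 pM) hB.
have uE : uniq (elabels E) by rewrite elabels_events.
have sE : size E = size B by rewrite -(size_map fst B) -(elabels_events (rcons (map S M) 0) B) size_map.
set cs := [seq e.1.1 | e <- E & ~~ (e.1.2 < e.2)].
have unknot : vk_eq (gauss ltn n E) [::] := unknots_all n0 pM uB hB cB.
(* The invariant of the layered diagram vanishes as it is the unknot, so its negative crossings,
   which are the changed ones, make up half of all. *)
have scs : 2 * size cs = size B.
  have wpE : well_paired (gauss ltn n E) := gauss_well_paired ltn vE uE.
  have := (vk_eq_invariant unknot).2 wpE.
  rewrite gauss_index_writhe // -/E /index_writhe big_nil sE; set k := count _ E.
  have -> : size cs = k by rewrite size_map size_filter.
  by lia.
exists (size cs); split=> //; split.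
  apply: reach_cc_word; last by rewrite -gauss_layered.
  move=> c /mapP [e]; rewrite mem_filter => /andP[_ eE] ->.
  apply/mapP; exists (upper_letter positive e) => //.
  rewrite (perm_mem (perm_gauss positive vE)); apply/flatten_mapP; exists e => //.
  exact: mem_head.
(* The positive diagram has invariant [2 * size B], that is [4 * size cs], and [m] changes account
   for at most [4 * m]. *)
move=> m h; have := reach_index_writhe h (gauss_well_paired positive vE uE).
rewrite gauss_index_writhe // -/E sE /index_writhe big_nil /positive /= count_pred0.
by rewrite -{}scs; move: (size cs) => k; lia.
Qed.

(** * Reading the closure code pass by pass *)

Lemma pass_cat w1 w2 t pos : pass (w1 ++ w2) t pos =
  ((pass w1 t pos).1 ++ (pass w2 (t + size w1) (pass w1 t pos).2).1,
   (pass w2 (t + size w1) (pass w1 t pos).2).2).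
Proof.
elim: w1 t pos => [|g w1 IH] t pos /=; first by rewrite addn0; case: (pass _ _ _).
by rewrite IH addSnnS /= catA.
Qed.

Lemma pass_perm w t pos : (pass w t pos).2 = braid_perm w pos.
Proof. by elim: w t pos => //= g w IH t pos; rewrite IH. Qed.

Lemma pass_virtual ms t pos : (pass [seq (m, false) | m <- ms] t pos).1 = [::].
Proof. by elim: ms t pos => //= m ms IH t pos; rewrite IH. Qed.

Lemma virtual_block_perm s d pos : 
  braid_perm [seq (m, false) | m <- iota s d] pos =
  if pos == s then s + d else if s < pos <= s + d then pos.-1 else pos.
Proof.
elim: d s pos => [|d IH] s pos /=.
  by rewrite addn0; case: eqP => // ne; case: ifP => //; lia.
rewrite /braid_perm /= -/(braid_perm _ _) IH /move_pos.
case: (pos =P s) => [E|ne]; first by rewrite eqxx addSnnS.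
case: (pos =P s.+1) => [E|ne'].
  have -> : (s == s.+1) = false by lia.
  by rewrite ifF ?ifT //; lia.
by case: eqP => [|_]; [lia | case: ifP; case: ifP; lia].
Qed.

(** The positions in [ms] count from 0, those in braid words from 1. *)
Definition classical (ms : seq nat) : seq gen := [seq (m.+1, true) | m <- ms].

Lemma pass_classical (L : seq nat) ms t r : uniq L -> r \in L ->
  (forall m, m \in ms -> m.+1 < size L) ->
  pass (classical ms) t (index r L).+1 =
  (strand positive r (events L (zip (iota t (size ms)) ms)),
   (index r (act L (zip (iota t (size ms)) ms))).+1).
Proof.
elim: ms L t => //= m ms IH L t uL rL hm.
have mL := hm m (mem_head _ _).
have e1 : (index r L == m) = (r == nth 0 L m).
  by apply/eqP/eqP => [<-|->]; rewrite ?nth_index // index_uniq // ltnW.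
have e2 : (index r L == m.+1) = (r == nth 0 L m.+1).
  by apply/eqP/eqP => [<-|->]; rewrite ?nth_index // index_uniq.
have idx : move_pos m.+1 (index r L).+1 = (index r (swap m L)).+1.
  have := index_swap r uL mL; rewrite /move_pos !eqSS -e1 -e2.
  by case: eqP => [->|_]; [case: eqP => [|_] | case: eqP => [->|_]]; lia.
rewrite idx IH ?(perm_uniq (perm_swap _ _)) ?(perm_mem (perm_swap _ _)) //; last first.
  by move=> k km; rewrite size_swap; apply: hm; rewrite inE km orbT.
congr (_, _); rewrite /strand /=; congr (_ ++ _); rewrite !eqSS /event_letters /= e1 e2.
by case: (r == nth 0 L m) => //=; case: ifP.
Qed.

(** * The diagrams (i,j,k) *)

Lemma braid_perm_range n w pos : (forall g, g \in w -> 1 <= g.1 < n) ->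
  1 <= pos <= n -> 1 <= braid_perm w pos <= n.
Proof.
elim: w pos => //= g w IH pos hw hp; apply: IH => [h hin|].
  by apply: hw; rewrite inE hin orbT.
have := hw g (mem_head _ _); rewrite /move_pos; case: (pos =P _) => _; first by lia.
by case: eqP => _; lia.
Qed.

Lemma passesE w n pos :
  passes w n pos = flatten [seq (pass w 0 (iter r (braid_perm w) pos)).1 | r <- iota 0 n].
Proof.
elim: n pos => //= n IH pos; rewrite IH pass_perm (iotaDl 1 0) -map_comp.
by congr (_ ++ flatten _); apply: eq_map => r; rewrite /= -iterSr.
Qed.

Section Knot.
Variables (n : nat) (ms : seq nat).
Let w := block n false ++ classical ms.
Let T := traject (braid_perm w) 1 n.
(** The pass ending at a position is the predecessor of the one starting there. Entry [q] belongs to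
    position [q.+2]: positions count from 1, and the top one is reserved for the last pass. *)
Let M := [seq (index q.+2 T).-1 | q <- iota 0 n.-1].
(** The labels begin after the [n.-1] virtual crossings, which take up indices in the braid word. *)
Let B := zip (iota n.-1 (size ms)) ms.
Let L0 := rcons (map S M) 0.
Let P r := iter r (braid_perm w) 1.
Hypotheses (n0 : 0 < n) (hms : forall m, m \in ms -> m.+1 < n) (knot : closure_is_knot n w).

Lemma orbit_range r : 1 <= P r <= n.
Proof.
elim: r => [|r IH]; first by rewrite /P /=.
apply: braid_perm_range IH => g; rewrite mem_cat => /orP[] /mapP [m hm ->] /=.
  by move: hm; rewrite mem_iota; lia.
exact: hms.
Qed.

(** A repetition would confine the orbit to [n.-1] positions, while the knot visits all [n]. *)
Lemma orbit_uniq : uniq T.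
Proof.
rewrite /T -(prednK n0) looping_uniq; apply/negP => /loopingP h.
have := @uniq_leq_size _ (iota 1 n) (traject (braid_perm w) 1 n.-1) (iota_uniq _ _).
rewrite size_iota size_traject => h'; suff : n <= n.-1 by lia.
apply: h' => p; rewrite mem_iota => pn; have [|r <-] := knot (p := p); [lia | apply: h].
Qed.

Lemma mem_orbit p : (p \in T) = (1 <= p <= n).
Proof.
have sub : {subset T <= iota 1 n}.
  by move=> q /trajectP [r _ ->]; rewrite mem_iota add1n ltnS; apply: orbit_range.
have [|_ ->] := uniq_min_size orbit_uniq sub.
  by rewrite size_iota size_traject.
by rewrite mem_iota; lia.
Qed.

Lemma index_orbit r : r < n -> index (P r) T = r.
Proof.
by move=> rn; rewrite /P -(nth_traject _ rn) index_uniq ?orbit_uniq ?size_traject.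
Qed.

Lemma orbit_index p : 1 <= p <= n -> index p T < n /\ P (index p T) = p.
Proof.
rewrite -mem_orbit => pT; have iT : index p T < n by move: pT; rewrite -index_mem size_traject.
by split=> //; rewrite /P -(nth_traject _ iT) nth_index.
Qed.

Lemma index_orbit_gt0 p : 1 < p <= n -> 0 < index p T.
Proof.
move=> pn; have [_] := @orbit_index p ltac:(lia).
by case: (index p T) => //; rewrite /P /=; lia.
Qed.

Lemma nth_passes r : 0 < r < n -> P r >= 2 /\ nth 0 M (P r - 2) = r.-1.
Proof.
move=> rn; have iP : index (P r) T = r by apply: index_orbit; lia.
have i0 : index 1 T = 0 := @index_orbit 0 n0.
have ne : P r <> 1 by move=> e; rewrite e i0 in iP; lia.
have := orbit_range r; move: (P r) iP ne => p iP ne.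
move=> Pn; split; first by lia.
rewrite /M (nth_map 0) ?size_iota; last by lia.
by rewrite nth_iota; [rewrite add0n -addn2 subnK ?iP; lia | lia].
Qed.

Lemma perm_passes : perm_eq M (iota 0 n.-1).
Proof.
have uM : uniq M.
  rewrite map_inj_in_uniq ?iota_uniq // => q1 q2; rewrite !mem_iota => h1 h2 e.
  have [_ e1] := @orbit_index q1.+2 ltac:(lia); have [_ e2] := @orbit_index q2.+2 ltac:(lia).
  have := @index_orbit_gt0 q1.+2; have := @index_orbit_gt0 q2.+2 => g2 g1.
  have ee : index q1.+2 T = index q2.+2 T by lia.
  by move: e1; rewrite ee e2; lia.
have sub : {subset M <= iota 0 n.-1}.
  move=> x /mapP [q]; rewrite !mem_iota => hq ->.
  by have [] := @orbit_index q.+2 ltac:(lia); have := @index_orbit_gt0 q.+2; lia.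
apply: uniq_perm => //; first exact: iota_uniq.
by have [|//] := uniq_min_size uM sub; rewrite size_map.
Qed.

Lemma perm_L0 : perm_eq L0 (iota 0 n).
Proof. exact: perm_start n0 perm_passes. Qed.

Lemma size_L0 : size L0 = n.
Proof. by rewrite (perm_size perm_L0) size_iota. Qed.

Lemma after_virtual r : r < n -> braid_perm (block n false) (P r) = (index r L0).+1.
Proof.
move=> rn; rewrite virtual_block_perm; have Pr := orbit_range r.
have sM : size M = n.-1 by rewrite size_map size_iota.
case: r rn Pr => [|r] rn Pr.
  rewrite /L0 -cats1 index_cat ifF; last by apply/mapP => -[].
  by rewrite size_map sM /=; lia.
have [P2 nM] := @nth_passes r.+1 ltac:(lia).
have -> : (P r.+1 == 1) = false by lia.
rewrite ifT; last by lia.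
have rM : nth 0 L0 (P r.+1 - 2) = r.+1.
  rewrite /L0 nth_rcons size_map sM ifT; last by lia.
  by rewrite (nth_map 0) ?nM // sM; lia.
by rewrite -{2}rM index_uniq ?(perm_uniq perm_L0) ?iota_uniq ?size_L0; lia.
Qed.

Lemma pass_orbit r : r < n ->
  pass w 0 (P r) = (strand positive r (events L0 B), (index r (act L0 B)).+1).
Proof.
move=> rn; rewrite /w pass_cat /block pass_virtual pass_perm after_virtual //.
rewrite size_map size_iota add0n pass_classical //.
- by rewrite (perm_uniq perm_L0) iota_uniq.
- by rewrite (perm_mem perm_L0) mem_iota.
- by rewrite size_L0.
Qed.

Lemma closes_passes : closes n M B.
Proof.
rewrite /closes -/L0; have pL : perm_eq (act L0 B) (iota 0 n).
  exact: perm_trans (perm_act _ _) perm_L0.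
have sL : size (act L0 B) = n by rewrite (perm_size pL) size_iota.
have sM : size M = n.-1 by rewrite size_map size_iota.
(* Each pass ends where the next one starts. *)
have idx r : r < n -> (index r (act L0 B)).+1 = P r.+1.
  by move=> rn; rewrite /P iterS -/(P r) -(pass_perm w 0) pass_orbit.
have tl : behead (act L0 B) = M.
  apply: (@eq_from_nth _ 0); first by rewrite size_behead sL sM.
  rewrite size_behead sL => q qn; rewrite nth_behead.
  have [iq e] := @orbit_index q.+2 ltac:(lia); have ig := @index_orbit_gt0 q.+2 ltac:(lia).
  rewrite [RHS](nth_map 0) ?size_iota // nth_iota // add0n.
  have := idx (index q.+2 T).-1; rewrite prednK // e => /(_ ltac:(lia)) [qE].
  rewrite -[in LHS]qE.
  by rewrite nth_index // (perm_mem pL) mem_iota; lia.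
(* The top entry is found by elimination: [n.-1] is the only pass missing from [M]. *)
case: (act L0 B) tl sL pL => [|x L] /= tl sL pL; first by lia.
rewrite {}tl in sL pL *; congr (_ :: _).
have xn : x \in iota 0 n by rewrite -(perm_mem pL) mem_head.
have xM : x \notin iota 0 n.-1.
  by rewrite -(perm_mem perm_passes); have := perm_uniq pL; rewrite iota_uniq /= => /andP[].
by move: xn xM; rewrite !mem_iota; lia.
Qed.

Lemma closure_code_gauss : closure_code n w = gauss positive n (events L0 B).
Proof.
rewrite /closure_code passesE /gauss /strands subn0; congr flatten.
by apply/eq_in_map => r; rewrite mem_iota => rn; rewrite -/(P r) pass_orbit.
Qed.

Lemma knot_vu : exists u, is_vu (closure_code n w) u /\ 2 * u = size ms.
Proof.
have sB : size (iota n.-1 (size ms)) = size ms by rewrite size_iota.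
have [||u [hu su]] := closed_braid_vu n0 perm_passes _ _ closes_passes.
- by rewrite -/(unzip1 B) unzip1_zip ?iota_uniq // sB.
- move=> c cB; apply: hms; have : c.2 \in unzip2 B := map_f snd cB.
  by rewrite unzip2_zip ?sB.
by exists u; rewrite closure_code_gauss su size2_zip ?sB.
Qed.
End Knot.

Lemma braid_ijk_classical i j k : braid_ijk i j k =
  block i false ++ classical (flatten (nseq (j - 1) (iota 0 (i - 1))) ++ rev (iota 0 k)).
Proof.
rewrite /braid_ijk /VB1 -catA; congr (_ ++ _); rewrite /classical map_cat; congr (_ ++ _).
  rewrite map_flatten map_nseq /block -!subn1; congr (flatten (nseq _ _)).
  by rewrite (iotaDl 1 0) -map_comp.
by rewrite /Bk !map_rev (iotaDl 1 0) -map_comp.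
Qed.

Theorem theorem3p2 (i j k : nat) :
  0 < j -> k < i -> closure_is_knot i (braid_ijk i j k) ->
  virtually_null_homotopic (diag_ijk i j k) /\
  exists n, is_vu (diag_ijk i j k) n /\ 2 * n = (i - 1) * (j - 1) + k.
Proof.
move=> _ ki; rewrite /diag_ijk braid_ijk_classical => knot.
have [|m|u [[hu mu] su]] := knot_vu _ _ knot; first by lia.
  rewrite mem_cat mem_rev mem_iota => /orP[/flattenP [s]|]; last by lia.
  by rewrite mem_nseq => /andP[_ /eqP ->]; rewrite mem_iota; lia.
split; first by exists u.
exists u; split=> //; rewrite su size_cat size_rev size_iota.
by rewrite size_flatten /shape map_nseq size_iota sumn_nseq.
Qed.
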